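(* Let $P_1,P_2,P_3,P_4,P_5\in\mathbb{P}^2_{\mathbb{C}}$ be a $V$-configuration such that \[ P_1=P_2\times P_4, \] and suppose there is a ternary cubic form with $7$ eigenpoints (i.e. with reduced zero-dimensional eigenscheme), five of which are $P_1,\dots,P_5$. Then the remaining eigenpoints $P_6$ and $P_7$ are given (in suitable order) by \[ P_6=(s_{15}s_{24}s_{34}+s_{15}s_{23}s_{44}-s_{13}s_{25}s_{44}-s_{13}s_{24}s_{45})\,P_2+(s_{13}s_{24}s_{25}-2s_{15}s_{22}s_{34}+s_{13}s_{22}s_{45})\,P_4, \] \[ P_7=(s_{26}s_{15}s_{46}+s_{24}s_{15}s_{66})\,P_1+s_{11}(s_{26}s_{45}+s_{24}s_{56})\,P_6 . \] Therefore $(P_2,P_4,P_6)$ are aligned, and the seven points are in a $(C_5)$ configuration. Furthermore, for a general choice of a $V$-configuration $P_1,\dots,P_5$ such that $P_1=P_2\times P_4$ and such that there is a ternary cubic form with reduced zero-dimensional eigenscheme having $P_1,\dots,P_5$ among its $7$ eigenpoints, the $(C_5)$ configuration is strict, but there are sub-cases in which $(P_2,P_5,P_7)$ or $(P_3,P_4,P_7)$ or $(P_3,P_5,P_6)$ are aligned; in all these cases the points are in a $(C_8)$ configuration (up to relabelling the points).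
   Context: Work in $\mathbb{P}^2_{\mathbb{C}}$. For a nonzero ternary cubic form $f$, the eigenscheme $E(f)\subset\mathbb{P}^2$ is defined by the $2\times2$ minors of $\begin{pmatrix}x&y&z\\ \partial_xf&\partial_yf&\partial_zf\end{pmatrix}$; its points are the eigenpoints of $f$. Put $s_{ij}=\langle P_i,P_j\rangle$ with $\langle (A,B,C),(A',B',C')\rangle=AA'+BB'+CC'$ (for chosen representing vectors), and let $\times$ be the cross product of representing vectors. Equalities of points are equalities in $\mathbb{P}^2$; right-hand sides are multihomogeneous expressions in the coordinates. A $V$-configuration is a tuple of five distinct points $P_1,\dots,P_5$ such that $P_1,P_2,P_3$ are aligned, $P_1,P_4,P_5$ are aligned, and $P_1,P_2,P_4$ are not aligned. Seven distinct points are in a $(C_5)$ configuration if the triples with indices $(1,2,3),(1,4,5),(1,6,7),(2,4,6)$ are aligned, and in a $(C_8)$ configuration if the triples $(1,2,3),(1,4,5),(1,6,7),(2,4,6),(2,5,7),(3,4,7)$ are aligned. A configuration is strict if there are no further aligned triples.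
   Formalization: P6, P7 are shown to be the remaining eigenpoints of every such cubic only if s22 ≠ 0 or s44 ≠ 0; if s22 = s44 = 0 this is false, and it is shown only that some cubic with reduced zero-dimensional eigenscheme has exactly P1,…,P5 and the two given points as eigenpoints. *)

(* Defs.v *)
From mathcomp Require Import all_boot all_order all_algebra all_fingroup.
From mathcomp Require Import reals complex mpoly.

Set Implicit Arguments.
Unset Strict Implicit.
Unset Printing Implicit Defensive.

Import GRing.Theory.
Local Open Scope ring_scope.

(* A point of the projective plane is given by a nonzero representing row
   vector; two nonzero vectors represent the same point when they span the same
   line. An n-tuple of points is an n x 3 matrix whose rows represent them. *)

Definition same_point (F : fieldType) (u v : 'rV[F]_3) : bool := (u == v)%MS.

(* The point labelled k in 1, ..., n+1; the rows themselves are numbered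
   from 0. *)
Definition pt (F : fieldType) n (P : 'M[F]_(n.+1, 3)) (k : nat) : 'rV[F]_3 :=
  row (inord k.-1) P.

(* The bilinear form, without complex conjugation: there are nonzero vectors
   with dot u u = 0. *)
Definition dot (F : fieldType) (u v : 'rV[F]_3) : F :=
  \sum_(k < 3) u 0 k * v 0 k.

(* k + 1 and k + 2 are computed modulo 3 in 'I_3. *)
Definition cross (F : fieldType) (u v : 'rV[F]_3) : 'rV[F]_3 :=
  \row_(k < 3) (u 0 (k + 1) * v 0 (k + 2) - u 0 (k + 2) * v 0 (k + 1)).

Definition distinct_points (F : fieldType) n (P : 'M[F]_(n, 3)) : Prop :=
  (forall i, row i P != 0) /\
  (forall i j, i != j -> ~~ same_point (row i P) (row j P)).

Definition aligned (F : fieldType) n (P : 'M[F]_(n, 3)) (T : {set 'I_n}) :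
    Prop :=
  exists2 l : 'cV[F]_3, l != 0 & forall i, i \in T -> row i P *m l = 0.

(* The rows of the points labelled i, j, k (labels start at 1). *)
Definition triple n (i j k : nat) : {set 'I_n.+1} :=
  [set inord i.-1; inord j.-1; inord k.-1].

Definition V_configuration (F : fieldType) (P : 'M[F]_(5, 3)) : Prop :=
  [/\ distinct_points P, aligned P (triple 4 1 2 3),
      aligned P (triple 4 1 4 5) & ~ aligned P (triple 4 1 2 4)].

Definition C5_lines : {set {set 'I_7}} :=
  [set triple 6 1 2 3; triple 6 1 4 5; triple 6 1 6 7; triple 6 2 4 6].

Definition C8_lines : {set {set 'I_7}} :=
  [set triple 6 1 2 3; triple 6 1 4 5; triple 6 1 6 7;
       triple 6 2 4 6; triple 6 2 5 7; triple 6 3 4 7].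

Definition configuration (F : fieldType) (L : {set {set 'I_7}})
    (Q : 'M[F]_(7, 3)) : Prop :=
  distinct_points Q /\ (forall T, T \in L -> aligned Q T).

Definition strict_configuration (F : fieldType) (L : {set {set 'I_7}})
    (Q : 'M[F]_(7, 3)) : Prop :=
  configuration L Q /\
  (forall T : {set 'I_7}, #|T| = 3%N -> aligned Q T -> T \in L).

Definition cubic_form (F : fieldType) (f : {mpoly F[3]}) : Prop :=
  f != 0 /\ f \is 3.-homog.

Definition eigenmatrix (F : fieldType) (f : {mpoly F[3]}) :
    'M[{mpoly F[3]}]_(1 + 1, 3) :=
  col_mx (\row_k 'X_k) (\row_k f^`M(k)).

Definition eigenminor (F : fieldType) (f : {mpoly F[3]}) (i j : 'I_3) :
    {mpoly F[3]} :=
  \det (row_mx (col i (eigenmatrix f)) (col j (eigenmatrix f))).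

Definition eigenideal (F : fieldType) (f g : {mpoly F[3]}) : Prop :=
  exists c : 'I_3 -> 'I_3 -> {mpoly F[3]},
    g = \sum_i \sum_j c i j * eigenminor f i j.

Definition eigenpoint (F : fieldType) (f : {mpoly F[3]}) (v : 'rV[F]_3) :
    Prop :=
  v != 0 /\ (forall i j, (eigenminor f i j).@[v 0] = 0).

(* The ideal of the homogeneous polynomials g whose fractions g / b, with b
   homogeneous of the degree of g and nonzero at v, vanish in the local ring of
   E(f) at v. *)
Definition local_eigenideal (F : fieldType) (f : {mpoly F[3]}) (v : 'rV[F]_3)
    (g : {mpoly F[3]}) : Prop :=
  exists d (h : {mpoly F[3]}),
    [/\ h \is d.-homog, h.@[v 0] != 0 & eigenideal f (h * g)].

(* The local rings of E(f) at its closed points have no nilpotents. *)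
Definition eigenscheme_reduced (F : fieldType) (f : {mpoly F[3]}) : Prop :=
  forall v, eigenpoint f v ->
  forall d (g : {mpoly F[3]}) n, g \is d.-homog ->
    local_eigenideal f v (g ^+ n) -> local_eigenideal f v g.

(* Finitely many closed points. There is always at least one over an
   algebraically closed field. *)
Definition eigenscheme_zero_dim (F : fieldType) (f : {mpoly F[3]}) : Prop :=
  exists s : seq 'rV[F]_3, forall v, eigenpoint f v -> has (same_point v) s.

(* The number of eigenpoints is not part of the definition: a zero-dimensional
   eigenscheme of a cubic form has degree 7. *)
Definition cubic_with_7_eigenpoints (F : fieldType) (f : {mpoly F[3]}) : Prop :=
  [/\ cubic_form f, eigenscheme_reduced f & eigenscheme_zero_dim f].

Definition has_eigenpoints (F : fieldType) n (f : {mpoly F[3]})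
    (P : 'M[F]_(n, 3)) : Prop :=
  forall i, eigenpoint f (row i P).

Definition eigenpoints_are (F : fieldType) n (f : {mpoly F[3]})
    (Q : 'M[F]_(n, 3)) : Prop :=
  has_eigenpoints f Q /\
  (forall v, eigenpoint f v -> exists i, same_point v (row i Q)).

Definition point6 (F : fieldType) (P : 'M[F]_(5, 3)) : 'rV[F]_3 :=
  let P1 := pt P 1 in let P2 := pt P 2 in let P3 := pt P 3 in
  let P4 := pt P 4 in let P5 := pt P 5 in
  let s13 := dot P1 P3 in let s15 := dot P1 P5 in
  let s22 := dot P2 P2 in let s23 := dot P2 P3 in
  let s24 := dot P2 P4 in let s25 := dot P2 P5 in
  let s34 := dot P3 P4 in let s44 := dot P4 P4 in let s45 := dot P4 P5 in
  (s15 * s24 * s34 + s15 * s23 * s44 - s13 * s25 * s44 - s13 * s24 * s45) *: P2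
  + (s13 * s24 * s25 - 2 * s15 * s22 * s34 + s13 * s22 * s45) *: P4.

Definition point7 (F : fieldType) (P : 'M[F]_(5, 3)) : 'rV[F]_3 :=
  let P1 := pt P 1 in let P2 := pt P 2 in
  let P4 := pt P 4 in let P5 := pt P 5 in let P6 := point6 P in
  let s11 := dot P1 P1 in let s15 := dot P1 P5 in
  let s24 := dot P2 P4 in let s26 := dot P2 P6 in
  let s45 := dot P4 P5 in let s46 := dot P4 P6 in
  let s56 := dot P5 P6 in let s66 := dot P6 P6 in
  (s26 * s15 * s46 + s24 * s15 * s66) *: P1
  + (s11 * (s26 * s45 + s24 * s56)) *: P6.

Definition seven_points (F : fieldType) (P : 'M[F]_(5, 3)) : 'M[F]_(7, 3) :=
  col_mx P (col_mx (point6 P) (point7 P)).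

Definition admissible (F : fieldType) (P : 'M[F]_(5, 3)) : Prop :=
  [/\ V_configuration P, same_point (pt P 1) (cross (pt P 2) (pt P 4)) &
      exists2 f, cubic_with_7_eigenpoints f & has_eigenpoints f P].

(* The coordinate k of the point in row i is the variable of index
   mxvec_index i k. *)
Definition multihomogeneous (F : fieldType) (G : {mpoly F[5 * 3]}) : Prop :=
  exists e : 'I_5 -> nat, forall m, m \in msupp G ->
    forall i, (\sum_(k < 3) m (mxvec_index i k))%N = e i.

Definition nonvanishing (F : fieldType) (G : {mpoly F[5 * 3]})
    (P : 'M[F]_(5, 3)) : bool :=
  G.@[mxvec P 0] != 0.

(* Every Zariski open set of quintuples of points is the union of the
   nonvanishing loci of the members of a finite list s of multihomogeneous
   polynomials; the property has to hold on the trace on W of such an open set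
   whose trace on W is dense in W. *)
Definition holds_for_general (F : fieldType) (W : 'M[F]_(5, 3) -> Prop)
    (property : 'M[F]_(5, 3) -> Prop) : Prop :=
  exists s : seq {mpoly F[5 * 3]},
    [/\ forall G, G \in s -> multihomogeneous G,
        forall H, multihomogeneous H ->
          (exists2 P, W P & nonvanishing H P) ->
          exists P, [/\ W P, nonvanishing H P
                        & has (fun G => nonvanishing G P) s]
      & forall P, W P -> has (fun G => nonvanishing G P) s -> property P].

Definition special_lines : {set {set 'I_7}} :=
  [set triple 6 2 5 7; triple 6 3 4 7; triple 6 3 5 6].

(* Main.v *)
(* In the coordinates x along P1 and v along P2, P4, the five eigenpoints force
   f = x^3 + C(v) up to a factor, unless P2 and P4 are both isotropic. The
   remaining eigenpoints are the third eigenpoint P6 of the binary cubic C, on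
   the line P2 P4, and a point P7 on the line P1 P6; together with P3 and P5 they
   come from the eigenvalues of C at P2, P4 and P6. The scheme is reduced if and
   only if P6 and P7 are distinct from the other points. When P2 and P4 are both
   isotropic this always holds, and the same f can still be used. The triples
   {2,5,7}, {3,4,7}, {3,5,6} are aligned according to the vanishing of
   three polynomials, and the vanishing of one of them
   forces that of a second one, which gives (C8). *)
Require Import Defs.
From mathcomp Require Import all_boot all_order all_algebra all_fingroup.
From mathcomp Require Import reals complex mpoly ring.
Local Open Scope ring_scope.
Local Open Scope complex_scope.

Set Implicit Arguments.
Unset Strict Implicit.
Unset Printing Implicit Defensive.
Import GRing.Theory Num.Theory.

(** Since P1 = P2 x P4 is orthogonal to P2 and P4, the Gram matrix of the frame P1, P2, P4 is block
    diagonal. Applying the adjugate of its lower block to the minors makes them split: the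
    eigenideal becomes (x m l1, x n l2, m n l3) with linear forms such that l1 - l2 + l3 = 0. Hence
    the eigenpoints are the vertices of a triangle, one point on each side and the common point of
    three concurrent lines; they are all rational, so the argument runs over any [numFieldType]. No
    degree count is used. Reducedness is tested point by point: two independent linear forms in the
    local ideal give a reduced point, whereas a collision produces an explicit nilpotent form whose
    derivative along a tangent direction is nonzero. Admissible quintuples are parametrised by the
    complement of a hypersurface in an affine space, which turns the density of strict
    configurations into a statement on nonzero polynomials in one variable. *)

(** * Homogeneous polynomials, directional derivatives and frames *)

Lemma mderiv_homog (F : fieldType) n d (p : {mpoly F[n]}) i :
  p \is d.+1.-homog -> p^`M(i) \is d.-homog.
Proof.
move=> /dhomogP hp; apply/dhomogP => m; rewrite mcoeff_msupp mcoeff_deriv => hm.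
have: (m + U_(i))%MM \in msupp p.
  by rewrite mcoeff_msupp; apply: contra hm => /eqP ->; rewrite mul0rn.
by move/hp; rewrite /= mdegD mdeg1 addn1 => -[].
Qed.

Lemma euler (F : fieldType) n d (p : {mpoly F[n]}) :
  p \is d.-homog -> \sum_i 'X_i * p^`M(i) = p *+ d.
Proof.
move=> /dhomogP hp; rewrite [in RHS](mpolyE p) -sumrMnl.
under eq_bigr => i _ do rewrite [in X in X^`M(i)](mpolyE p) raddf_sum mulr_sumr.
rewrite exchange_big /= [LHS]big_seq [RHS]big_seq.
apply: eq_bigr => m /hp /= <-.
under eq_bigr => i _ do rewrite mderivZ mderivX.
rewrite mdegE -sumrMnr; apply: eq_bigr => i _.
case: (posnP (m i)) => [->|mi]; first by rewrite mulr0n scale0r scaler0 mulr0.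
have le : (U_(i) <= m)%MM by apply/mnm_lepP => j; rewrite mnm1E; case: eqP => // <-.
have <- : 'X_[m - U_(i)] * 'X_i = 'X_[m] :> {mpoly F[n]} by rewrite -mpolyXD submK.
by rewrite scaler_nat -scalerAr scalerMnr mulrnAr mulrC.
Qed.

Section Frame.
Variable F : fieldType.
Implicit Types (u v w : 'rV[F]_3) (p q : {mpoly F[3]}) (B : 'M[F]_3).

Definition lin_form u : {mpoly F[3]} := \sum_i (u 0 i)%:MP * 'X_i.

Definition dir_deriv u p : {mpoly F[3]} := \sum_i (u 0 i)%:MP * p^`M(i).

(* For u and v in a basis these generate the eigenideal; in the frame P1, P2, P4
   they become simpler than the minors themselves. *)
Definition contracted_minor p u v : {mpoly F[3]} := lin_form u * dir_deriv v p - lin_form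
    v * dir_deriv u p.

(* The coordinates dual to the basis formed by the rows of B. *)
Definition frame_coord B k : {mpoly F[3]} := \sum_i (invmx B i k)%:MP * 'X_i.

Lemma dir_derivD u : {morph dir_deriv u : p q / p + q}.
Proof.
move=> p q; rewrite /dir_deriv -big_split; apply: eq_bigr => i _.
by rewrite mderivD mulrDr.
Qed.

Lemma dir_derivC u c : dir_deriv u c%:MP = 0.
Proof. by rewrite /dir_deriv big1 // => i _; rewrite mderivC mulr0. Qed.

Lemma dir_deriv_nat u k : dir_deriv u k%:R = 0.
Proof. by rewrite -mpolyC1 -mpolyCMn dir_derivC. Qed.

Lemma dir_derivB u : {morph dir_deriv u : p q / p - q}.
Proof.
move=> p q; rewrite /dir_deriv -sumrB; apply: eq_bigr => i _.
by rewrite mderivB mulrBr.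
Qed.

Lemma dir_derivM u p q : dir_deriv u (p * q) = dir_deriv u p * q + p * dir_deriv u q.
Proof.
rewrite /dir_deriv mulr_suml mulr_sumr -big_split; apply: eq_bigr => i _ /=.
by rewrite mderivM; ring.
Qed.

Lemma dir_derivCM u c p : dir_deriv u (c%:MP * p) = c%:MP * dir_deriv u p.
Proof. by rewrite dir_derivM dir_derivC mul0r add0r. Qed.

Lemma dir_derivX u p n : dir_deriv u (p ^+ n.+1) = p ^+ n * dir_deriv u p *+ n.+1.
Proof.
elim: n => [|n IHn]; first by rewrite expr0 mul1r.
by rewrite exprS dir_derivM IHn (exprS p n) (mulrS _ n.+1); ring.
Qed.

Lemma dir_deriv_sum u I (r : seq I) (P : pred I) (G : I -> {mpoly F[3]}) :
  dir_deriv u (\sum_(i <- r | P i) G i) = \sum_(i <- r | P i) dir_deriv u (G i).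
Proof.
by elim/big_rec2: _ => [|i p q _ <-]; [rewrite -[0]mpolyC0 dir_derivC | rewrite dir_derivD].
Qed.

Lemma dir_deriv_comm u v p : dir_deriv u (dir_deriv v p) = dir_deriv v (dir_deriv u p).
Proof.
rewrite /dir_deriv.
under eq_bigr => i _ do rewrite raddf_sum mulr_sumr.
under [RHS]eq_bigr => i _ do rewrite raddf_sum mulr_sumr.
rewrite exchange_big; apply: eq_bigr => i _; apply: eq_bigr => j _ /=.
by rewrite !mderiv_mulC mderiv_comm; ring.
Qed.

Lemma dir_deriv_homog d u p : p \is d.+1.-homog -> dir_deriv u p \is d.-homog.
Proof.
by move=> hp; apply: rpred_sum => i _; rewrite mul_mpolyC dhomogZ // mderiv_homog.
Qed.

Lemma mderivXU i j : ('X_j : {mpoly F[3]})^`M(i) = (j == i)%:R.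
Proof.
rewrite mderivX mnm1E; case: eqP => [->|_]; last by rewrite scale0r.
by rewrite scale1r -[X in (X - _)%MM]add0m addmK mpolyX0.
Qed.

Lemma dir_deriv_coord B k l : B \in unitmx -> dir_deriv (row k B) (frame_coord B l) = (k
    == l)%:R.
Proof.
move=> uB; transitivity ((B *m invmx B) k l)%:MP_[3]; last first.
  by rewrite mulmxV // mxE; case: eqP => _; rewrite ?mpolyC1 ?mpolyC0.
rewrite mxE raddf_sum; apply: eq_bigr => i _ /=; rewrite mxE mpolyCM.
congr (_ * _); rewrite raddf_sum (bigD1 i) //= mderiv_mulC mderivXU eqxx mulr1.
by rewrite big1 ?addr0 // => j ji; rewrite mderiv_mulC mderivXU (negPf ji) mulr0.
Qed.

Lemma meval_coord B k v : (frame_coord B k).@[v 0] = (v *m invmx B) 0 k.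
Proof.
rewrite /frame_coord mxE raddf_sum; apply: eq_bigr => i _ /=.
by rewrite mevalM mevalC mevalXU mulrC.
Qed.

Lemma var_coord B i : B \in unitmx -> 'X_i = \sum_k (B k i)%:MP * frame_coord B k.
Proof.
move=> uB; rewrite /frame_coord; under eq_bigr => k _ do rewrite mulr_sumr.
rewrite exchange_big (bigD1 i) //=.
have e j : \sum_k (B k i)%:MP * ((invmx B j k)%:MP * 'X_j)
    = ((j == i)%:R)%:MP_[3] * 'X_j :> {mpoly F[3]}.
  transitivity (((invmx B *m B) j i)%:MP_[3] * 'X_j : {mpoly F[3]}); last first.
    by rewrite mulVmx // mxE.
  rewrite mxE raddf_sum mulr_suml; apply: eq_bigr => k _ /=.
  by rewrite mpolyCM; ring.
rewrite e eqxx mpolyC1 mul1r big1 ?addr0 // => j ji.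
by rewrite e (negPf ji) mpolyC0 mul0r.
Qed.

(** Inserts [invmx B *m B = 1]. Stated for any family [g] because it serves both the partial
    derivatives and the variables. *)
Lemma frame_resolution B i (g : 'I_3 -> {mpoly F[3]}) : B \in unitmx ->
  g i = \sum_k (invmx B i k)%:MP * (\sum_j (row k B 0 j)%:MP * g j).
Proof.
move=> uB; under eq_bigr => k _ do rewrite mulr_sumr.
rewrite exchange_big (bigD1 i) //=.
have e j : \sum_k (invmx B i k)%:MP * ((row k B 0 j)%:MP * g j)
    = ((i == j)%:R)%:MP_[3] * g j :> {mpoly F[3]}.
  transitivity (((invmx B *m B) i j)%:MP_[3] * g j : {mpoly F[3]}).
    rewrite mxE raddf_sum mulr_suml; apply: eq_bigr => k _ /=.
    by rewrite mxE mpolyCM; ring.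
  by rewrite mulVmx // mxE.
rewrite e eqxx mpolyC1 mul1r big1 ?addr0 // => j ji.
by rewrite e eq_sym (negPf ji) mpolyC0 mul0r.
Qed.

Lemma mderiv_dir_deriv B i p : B \in unitmx ->
  p^`M(i) = \sum_k (invmx B i k)%:MP * dir_deriv (row k B) p.
Proof. exact: (frame_resolution i (fun j => p^`M(j))). Qed.

Lemma var_lin_form B i : B \in unitmx ->
  'X_i = \sum_k (invmx B i k)%:MP * lin_form (row k B).
Proof. exact: (frame_resolution i (fun j => 'X_j)). Qed.

(** [lin_form u] is the form [dot u], so its coefficients on the dual coordinates are scalar
    products with the frame. This is where the orthogonality of P1 to P2 and P4 will enter the
    minors. *)
Lemma lin_form_coord B u : B \in unitmx ->
  lin_form u = \sum_k (dot u (row k B))%:MP * frame_coord B k.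
Proof.
move=> uB; rewrite /lin_form.
under eq_bigr => i _ do rewrite (var_coord i uB) mulr_sumr.
rewrite exchange_big; apply: eq_bigr => k _ /=.
rewrite /dot raddf_sum mulr_suml; apply: eq_bigr => i _ /=.
by rewrite mxE mpolyCM; ring.
Qed.

End Frame.

(** * Eigenideals, local ideals and reduced points *)

(** The size is written [1 + 1] to match the [col_mx] and [row_mx] blocks of [eigenminor]. *)
Lemma det22 (R : comNzRingType) (A : 'M[R]_(1 + 1)) :
  \det A = A (lshift 1 0) (lshift 1 0) * A (rshift 1 0) (rshift 1 0)
         - A (lshift 1 0) (rshift 1 0) * A (rshift 1 0) (lshift 1 0).
Proof.
rewrite (expand_det_row _ (lshift 1 0)) big_split_ord !big_ord1.
rewrite /cofactor !det_mx11 !mxE expr0 expr1 mul1r mulN1r mulrN.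
by do ![congr (_ + _) | congr (- _) | congr (_ * _)]; congr (A _ _); apply: val_inj.
Qed.

Lemma eigenminorE (F : fieldType) (p : {mpoly F[3]}) i j :
  eigenminor p i j = 'X_i * p^`M(j) - 'X_j * p^`M(i).
Proof.
have eu k : eigenmatrix p (lshift 1 0) k = 'X_k.
  by rewrite /eigenmatrix col_mxEu mxE.
have ed k : eigenmatrix p (rshift 1 0) k = p^`M(k).
  by rewrite /eigenmatrix col_mxEd mxE.
rewrite /eigenminor; move: (eigenmatrix p) eu ed => M eu ed.
by rewrite det22 !row_mxEl !row_mxEr; rewrite 4!mxE !eu !ed.
Qed.

Section Eigenideal.
Variable F : fieldType.
Implicit Types (u v w : 'rV[F]_3) (f g h : {mpoly F[3]}) (B : 'M[F]_3).

Lemma eigenidealD f g h :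
  eigenideal f g -> eigenideal f h -> eigenideal f (g + h).
Proof.
move=> [c ->] [c' ->]; exists (fun i j => c i j + c' i j).
rewrite -big_split; apply: eq_bigr => i _; rewrite -big_split.
by apply: eq_bigr => j _; rewrite mulrDl.
Qed.

Lemma eigenidealM f g h : eigenideal f g -> eigenideal f (h * g).
Proof.
move=> [c ->]; exists (fun i j => h * c i j).
rewrite mulr_sumr; apply: eq_bigr => i _; rewrite mulr_sumr.
by apply: eq_bigr => j _; rewrite mulrA.
Qed.

Lemma contracted_minorE f u v :
  contracted_minor f u v = \sum_i \sum_j (u 0 i * v 0 j)%:MP * eigenminor f i j.
Proof.
rewrite /contracted_minor [lin_form v * _]mulrC /lin_form /dir_deriv !big_distrlr -sumrB.
apply: eq_bigr => i _; rewrite -sumrB; apply: eq_bigr => j _ /=.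
by rewrite eigenminorE mpolyCM; ring.
Qed.

Lemma eigenideal_contracted_minor f u v : eigenideal f (contracted_minor f u v).
Proof. by exists (fun i j => (u 0 i * v 0 j)%:MP); rewrite contracted_minorE. Qed.

(** The row of variables and the gradient are expanded by the same matrix [invmx B], so their 2 x 2
    minors expand bilinearly. *)
Lemma eigenminor_frame f B i j : B \in unitmx ->
  eigenminor f i j = \sum_k \sum_l (invmx B i k * invmx B j l)%:MP *
                       contracted_minor f (row k B) (row l B).
Proof.
move=> uB; rewrite eigenminorE (var_lin_form i uB) (var_lin_form j uB).
rewrite (mderiv_dir_deriv i _ uB) (mderiv_dir_deriv j _ uB) /contracted_minor.
rewrite [X in _ - X]mulrC !big_distrlr -sumrB.
apply: eq_bigr => k _; rewrite -sumrB; apply: eq_bigr => l _ /=.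
by rewrite mpolyCM; ring.
Qed.

Lemma eigenideal_frame f g B : B \in unitmx -> eigenideal f g ->
  exists c : 'I_3 -> 'I_3 -> {mpoly F[3]},
    g = \sum_k \sum_l c k l * contracted_minor f (row k B) (row l B).
Proof.
move=> uB [c ->].
exists (fun k l => \sum_i \sum_j c i j * (invmx B i k * invmx B j l)%:MP).
under eq_bigr => i _ do under eq_bigr => j _ do
  rewrite (eigenminor_frame f i j uB) mulr_sumr.
under eq_bigr => i _ do rewrite exchange_big.
rewrite exchange_big; apply: eq_bigr => k _ /=.
under [RHS]eq_bigr => l _ do rewrite mulr_suml.
rewrite [RHS]exchange_big; apply: eq_bigr => i _ /=.
under [RHS]eq_bigr => l _ do rewrite mulr_suml.
rewrite [RHS]exchange_big; apply: eq_bigr => j _ /=.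
by rewrite mulr_sumr; apply: eq_bigr => l _; rewrite mulrA.
Qed.

Lemma eigenpointP f v B : B \in unitmx ->
  eigenpoint f v <->
  v != 0 /\ forall k l, (contracted_minor f (row k B) (row l B)).@[v 0] = 0.
Proof.
move=> uB; split=> -[v0 hv]; split=> // i j.
  rewrite contracted_minorE raddf_sum big1 // => k _; rewrite raddf_sum big1 // => l _.
  by rewrite /= mevalM hv mulr0.
rewrite (eigenminor_frame f i j uB) raddf_sum big1 // => k _.
by rewrite raddf_sum big1 // => l _; rewrite /= mevalM hv mulr0.
Qed.

Lemma eigenideal_eval f v g : eigenpoint f v -> eigenideal f g -> g.@[v 0] = 0.
Proof.
move=> [_ hv] [c ->]; rewrite raddf_sum big1 // => i _.
by rewrite raddf_sum big1 // => j _; rewrite /= mevalM hv mulr0.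
Qed.

Lemma meval_homogZ d g (k : F) v :
  g \is d.-homog -> g.@[(k *: v) 0] = k ^+ d * g.@[v 0].
Proof.
move=> /dhomogP hg; rewrite !mevalE mulr_sumr big_seq [RHS]big_seq.
apply: eq_bigr => m /hg /= <-; rewrite mulrCA; congr (_ * _).
rewrite mdegE -prodrXr -big_split; apply: eq_bigr => i _ /=.
by rewrite mxE exprMn.
Qed.

Lemma local_eigenidealD f v g h :
  local_eigenideal f v g -> local_eigenideal f v h -> local_eigenideal f v (g + h).
Proof.
move=> [d [a [ha av Ia]]] [e [b [hb bv Ib]]]; exists (d + e)%N, (a * b).
split; [exact: dhomogM | by rewrite mevalM mulf_neq0 |].
have -> : a * b * (g + h) = b * (a * g) + a * (b * h) by ring.
by apply: eigenidealD; apply: eigenidealM.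
Qed.

Lemma local_eigenidealM f v g h :
  local_eigenideal f v g -> local_eigenideal f v (h * g).
Proof.
move=> [d [a [ha av Ia]]]; exists d, a; split=> //.
have -> : a * (h * g) = h * (a * g) by ring.
exact: eigenidealM.
Qed.

Lemma local_eigenidealZ f (k : F) v g : k != 0 ->
  local_eigenideal f v g -> local_eigenideal f (k *: v) g.
Proof.
move=> k0 [d [a [ha av Ia]]]; exists d, a; split=> //.
by rewrite (meval_homogZ _ _ ha) mulf_neq0 ?expf_neq0.
Qed.

Lemma local_eigenideal_eval f v g :
  eigenpoint f v -> local_eigenideal f v g -> g.@[v 0] = 0.
Proof.
move=> ev [d [a [ha av Ia]]]; apply/eqP.
have /eqP := eigenideal_eval ev Ia.
by rewrite mevalM mulf_eq0 (negPf av).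
Qed.

Lemma same_pointP u v : v != 0 -> same_point u v -> exists2 k, k != 0 & u = k *: v.
Proof.
move=> v0; rewrite /same_point => /andP[/sub_rVP[k hk] /sub_rVP[k' hk']].
exists k => //; apply: contraNneq v0 => k0.
by rewrite hk' hk k0 scale0r scaler0.
Qed.

Lemma same_pointZ k v : k != 0 -> same_point (k *: v) v.
Proof. by move=> k0; rewrite /same_point; apply/eqmxP/eqmx_scale. Qed.

Lemma eigenpointZ f k v : k != 0 -> f \is 3.-homog ->
  eigenpoint f v -> eigenpoint f (k *: v).
Proof.
move=> k0 hf [v0 hv]; split=> [|i j]; first by rewrite scaler_eq0 negb_or k0.
have hm : eigenminor f i j \is 3.-homog.
  have hXd a b : 'X_a * f^`M(b) \is 3.-homog.
    apply: (@dhomogM _ _ _ 1%N _ 2%N); first by rewrite dhomogX /= mdeg1.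
    exact: mderiv_homog.
  by rewrite eigenminorE rpredB.
by rewrite (meval_homogZ _ _ hm) hv mulr0.
Qed.

(* w is a tangent direction of the eigenscheme at v, so it annihilates the
   differential of every g that is nilpotent in the local ring. *)
Lemma reduced_tangent f v w B d e g h n :
  B \in unitmx -> eigenscheme_reduced f -> eigenpoint f v ->
  (forall k l, (dir_deriv w (contracted_minor f (row k B) (row l B))).@[v 0] = 0) ->
  g \is d.-homog -> h \is e.-homog -> h.@[v 0] != 0 ->
  eigenideal f (h * g ^+ n) -> (dir_deriv w g).@[v 0] = 0.
Proof.
move=> uB red ev tw hg hh hv Ig.
have [d' [h' [_ hv' Ig']]] : local_eigenideal f v g.
  by apply: (red v ev d g n hg); exists e, h.
have gv : g.@[v 0] = 0.
  by apply: (local_eigenideal_eval ev); apply: (red v ev d g n hg); exists e, h.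
have [c E] := eigenideal_frame uB Ig'.
(* By Leibniz' rule every term of the derivative contains a contracted minor or its derivative along
   w, and both vanish at v. *)
have: (dir_deriv w (h' * g)).@[v 0] = 0.
  rewrite E dir_deriv_sum raddf_sum big1 // => k _.
  rewrite dir_deriv_sum raddf_sum big1 // => l _.
  have [_ ev'] := (eigenpointP f v uB).1 ev.
  by rewrite /= dir_derivM mevalD !mevalM ev' tw !mulr0 addr0 //.
rewrite dir_derivM mevalD !mevalM gv mulr0 add0r => /eqP.
by rewrite mulf_eq0 (negPf hv') => /eqP.
Qed.
End Eigenideal.

(* Euler's identity in the basis v, a, b: the only term of g that does not lie
   in the ideal (l1, l2) is the multiple of l0 ^+ d by g(v). *)
Lemma homog_span (F : numFieldType) (v a b : 'rV[F]_3) (l0 l1 l2 : {mpoly F[3]}) :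
  (forall i, 'X_i = (v 0 i)%:MP * l0 + (a 0 i)%:MP * l1 + (b 0 i)%:MP * l2) ->
  forall d (g : {mpoly F[3]}), g \is d.-homog -> g.@[v 0] = 0 ->
  exists q1 q2, g = q1 * l1 + q2 * l2.
Proof.
move=> hX; have E d (g : {mpoly F[3]}) : g \is d.-homog ->
    g *+ d = l0 * dir_deriv v g + l1 * dir_deriv a g + l2 * dir_deriv b g.
  move=> /euler <-; rewrite /dir_deriv !mulr_sumr -!big_split.
  by apply: eq_bigr => i _ /=; rewrite hX; ring.
elim=> [|d IHd] g hg gv.
  exists 0, 0; rewrite !mul0r addr0.
  have E0 : g = (g@_0)%:MP.
    apply: msize1_polyC; rewrite msizeE; apply/bigmax_leqP_seq => m hm _.
    by move/dhomogP: hg => /(_ m hm) /= ->.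
  by move: gv; rewrite E0 mevalC => ->; rewrite mpolyC0.
have Eg := E _ _ hg.
have dv : (dir_deriv v g).@[v 0] = 0.
  have := congr1 (meval (v 0)) (euler hg); rewrite mevalMn gv mul0rn => <-.
  rewrite /dir_deriv !raddf_sum; apply: eq_bigr => i _ /=.
  by rewrite !mevalM mevalC mevalXU.
have [q1 [q2 Ev]] := IHd _ (dir_deriv_homog v hg) dv.
pose k : F := d.+1%:R^-1.
exists (k%:MP * (l0 * q1 + dir_deriv a g)), (k%:MP * (l0 * q2 + dir_deriv b g)).
transitivity (k%:MP * (g *+ d.+1)).
  have kd : k *+ d.+1 = 1 by rewrite -mulr_natr mulVf ?pnatr_eq0.
  by rewrite mulrnAr -mulrnAl -mpolyCMn kd mpolyC1 mul1r.
by rewrite Eg Ev; ring.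
Qed.

(** A form with a power in the local ideal vanishes at v, so by [homog_span] it is a combination of
    l1 and l2. Two linear forms in the local ideal that cut out v therefore make the point
    reduced. *)
Lemma reduced_at (F : numFieldType) (f : {mpoly F[3]}) (v a b : 'rV[F]_3)
    (l0 l1 l2 : {mpoly F[3]}) :
  (forall i, 'X_i = (v 0 i)%:MP * l0 + (a 0 i)%:MP * l1 + (b 0 i)%:MP * l2) ->
  eigenpoint f v -> local_eigenideal f v l1 -> local_eigenideal f v l2 ->
  forall d (g : {mpoly F[3]}) n, g \is d.-homog ->
    local_eigenideal f v (g ^+ n) -> local_eigenideal f v g.
Proof.
move=> hX ev I1 I2 d g n hg In.
have gv : g.@[v 0] = 0.
  have /eqP := local_eigenideal_eval ev In.
  by rewrite rmorphXn expf_eq0 => /andP[_ /eqP].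
have [q1 [q2 ->]] := homog_span hX hg gv.
by apply: local_eigenidealD; apply: local_eigenidealM.
Qed.

Lemma ord3P (k : 'I_3) : [\/ k = 0, k = 1 | k = 2].
Proof.
case: k => [[|[|[|//]]] hk]; [exact/Or31/val_inj | exact/Or32/val_inj |].
exact/Or33/val_inj.
Qed.

Lemma sum3E (V : nmodType) (G : 'I_3 -> V) : \sum_i G i = G 0 + G 1 + G 2.
Proof.
rewrite !big_ord_recl big_ord0 addr0 addrA.
by congr (_ + _ + _); congr G; apply: val_inj.
Qed.

Definition row3 (F : nmodType) (x y z : F) : 'rV[F]_3 := \row_k [:: x; y; z]`_k.

Lemma row3_0 (F : nmodType) (x y z : F) : row3 x y z 0 0 = x. Proof. by rewrite mxE. Qed.
Lemma row3_1 (F : nmodType) (x y z : F) : row3 x y z 0 1 = y. Proof. by rewrite mxE. Qed.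
Lemma row3_2 (F : nmodType) (x y z : F) : row3 x y z 0 2 = z. Proof. by rewrite mxE. Qed.
Definition row3E := (row3_0, row3_1, row3_2).

Lemma row3P (F : nmodType) (v : 'rV[F]_3) : v = row3 (v 0 0) (v 0 1) (v 0 2).
Proof. by apply/rowP => k; case: (ord3P k) => ->; rewrite row3E. Qed.

Lemma scale_row3 (F : pzRingType) (k x y z : F) :
  k *: row3 x y z = row3 (k * x) (k * y) (k * z).
Proof. by apply/rowP => i; case: (ord3P i) => ->; rewrite mxE !row3E. Qed.

(** * The eigenschemes of f = C(y, z) + x^3 *)

(* In the coordinates x, m, n of the frame P1, P2, P4 the eigenideal is generated
   by three products of linear forms, x m l1, x n l2 and m n l3. The five
   parameters encode the positions of P3 and P5 and the scalar products of P2
   and P4. *)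
Section Net.
Variable F : numFieldType.
Variables (f : {mpoly F[3]}) (B : 'M[F]_3).
Variables (al ga U W be : F).
Hypothesis uB : B \in unitmx.
Hypothesis hf : f \is 3.-homog.

Let mm := ga - U.
Let nn := al - W.
Let E := al * mm + U * nn.

(** The forms satisfy [net_form1 - net_form2 + net_form3 = 0], so the three lines are concurrent. *)
Definition net_form1 : {mpoly F[3]} :=
  al%:MP * frame_coord B 1 + U%:MP * frame_coord B 2 - be%:MP * frame_coord B 0.
Definition net_form2 : {mpoly F[3]} :=
  ga%:MP * frame_coord B 2 + W%:MP * frame_coord B 1 - be%:MP * frame_coord B 0.
Definition net_form3 : {mpoly F[3]} :=
  mm%:MP * frame_coord B 2 - nn%:MP * frame_coord B 1.
Definition net1 := frame_coord B 0 * frame_coord B 1 * net_form1.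
Definition net2 := frame_coord B 0 * frame_coord B 2 * net_form2.
Definition net3 := frame_coord B 1 * frame_coord B 2 * net_form3.

Definition spanned_by_net := [/\ eigenideal f net1, eigenideal f net2,
  eigenideal f net3 & forall k l, exists c1 c2 c3 : F,
    contracted_minor f (row k B) (row l B) = c1%:MP * net1 + c2%:MP * net2 + c3%:MP * net3].

(** In the order of the labels. Points 1, 2, 4 are the vertices of the triangle x m n = 0; points 3,
    5, 6 are where the sides n = 0, m = 0, x = 0 meet [net_form1], [net_form2], [net_form3]; point 7
    is the common point of these three lines. *)
Definition net_points : seq 'rV[F]_3 :=
  [:: row3 1 0 0; row3 0 1 0; row3 al be 0; row3 0 0 1; row3 ga 0 be;
      row3 0 mm nn; row3 E (be * mm) (be * nn)].

Hypothesis span : spanned_by_net.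

Lemma coord_homog k : frame_coord B k \is 1.-homog.
Proof.
by apply: rpred_sum => i _; rewrite mul_mpolyC dhomogZ // dhomogX /= mdeg1.
Qed.

Lemma net_form1_homog : net_form1 \is 1.-homog.
Proof. by rewrite rpredB ?rpredD // mul_mpolyC dhomogZ // coord_homog. Qed.
Lemma net_form2_homog : net_form2 \is 1.-homog.
Proof. by rewrite rpredB ?rpredD // mul_mpolyC dhomogZ // coord_homog. Qed.
Lemma net_form3_homog : net_form3 \is 1.-homog.
Proof. by rewrite rpredB // mul_mpolyC dhomogZ // coord_homog. Qed.

Let evalE := (mevalM, mevalB, mevalD, mevalC).

Lemma meval_coord_frame (y : 'rV[F]_3) k : (frame_coord B k).@[(y *m B) 0] = y 0 k.
Proof. by rewrite meval_coord mulmxK. Qed.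

Lemma eigenpoint_net (y : 'rV[F]_3) : let x := y 0 0 in let m := y 0 1 in let n := y 0 2 in
  eigenpoint f (y *m B) <->
  [/\ y != 0, x * m * (al * m + U * n - be * x) = 0,
      x * n * (ga * n + W * m - be * x) = 0 & m * n * (mm * n - nn * m) = 0].
Proof.
have ev1 : net1.@[(y *m B) 0] = y 0 0 * y 0 1 * (al * y 0 1 + U * y 0 2 - be * y 0 0).
  by rewrite !evalE !meval_coord_frame.
have ev2 : net2.@[(y *m B) 0] = y 0 0 * y 0 2 * (ga * y 0 2 + W * y 0 1 - be * y 0 0).
  by rewrite !evalE !meval_coord_frame.
have ev3 : net3.@[(y *m B) 0] = y 0 1 * y 0 2 * (mm * y 0 2 - nn * y 0 1).
  by rewrite !evalE !meval_coord_frame.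
have y0 : (y *m B == 0) = (y == 0).
  by apply/eqP/eqP => [e|->]; [rewrite -(mulmxK uB y) e mul0mx | rewrite mul0mx].
have [I1 I2 I3 V] := span.
split=> [ev | [yn0 e1 e2 e3]].
  have [] := ev; rewrite y0 => yn0 _; split=> //; rewrite -?ev1 -?ev2 -?ev3.
  - exact: (eigenideal_eval ev I1).
  - exact: (eigenideal_eval ev I2).
  - exact: (eigenideal_eval ev I3).
apply/(eigenpointP _ _ uB); rewrite y0; split=> // k l.
have [c1 [c2 [c3 ->]]] := V k l.
rewrite -ev1 in e1; rewrite -ev2 in e2; rewrite -ev3 in e3.
move: net1 net2 net3 e1 e2 e3 {ev1 ev2 ev3} => N1 N2 N3 e1 e2 e3.
by rewrite !mevalD !mevalM e1 e2 e3 !mulr0 !addr0.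
Qed.

(** [reduced_at] in frame coordinates. The scalar k clears the denominators that appear when the
    coordinates are solved for l0, l1, l2. *)
Lemma reduced_net_at k (y a b : 'rV[F]_3) (l0 l1 l2 : {mpoly F[3]}) : k != 0 ->
  (forall j, k%:MP * frame_coord B j
     = (y 0 j)%:MP * l0 + (a 0 j)%:MP * l1 + (b 0 j)%:MP * l2) ->
  eigenpoint f (y *m B) ->
  local_eigenideal f (y *m B) l1 -> local_eigenideal f (y *m B) l2 ->
  forall d (g : {mpoly F[3]}) n, g \is d.-homog ->
    local_eigenideal f (y *m B) (g ^+ n) -> local_eigenideal f (y *m B) g.
Proof.
move=> k0 hX ev I1 I2; pose K := (k^-1)%:MP_[3].
apply: (@reduced_at _ _ _ (a *m B) (b *m B) (K * l0) (K * l1) (K * l2)) => //.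
- move=> i; rewrite (var_coord i uB).
  have kK : K * k%:MP = 1 by rewrite /K -mpolyCM mulVf ?mpolyC1.
  have e j : frame_coord B j
      = (y 0 j)%:MP * (K * l0) + (a 0 j)%:MP * (K * l1) + (b 0 j)%:MP * (K * l2).
    rewrite -[LHS]mul1r -kK -mulrA hX; ring.
  under eq_bigr => j _ do rewrite {1}e.
  by rewrite !mxE !sum3E; ring.
- exact: local_eigenidealM.
- exact: local_eigenidealM.
Qed.

(** Each generator is a product of three linear forms. Where two of them are nonzero they serve as a
    denominator, and the third lies in the local ideal. *)
Lemma local_net (y : 'rV[F]_3) (g h1 h2 e : {mpoly F[3]}) (c : F) :
  eigenideal f g -> h1 \is 1.-homog -> h2 \is 1.-homog -> h1 * h2 * e = g ->
  (h1 * h2).@[(y *m B) 0] = c -> c != 0 ->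
  local_eigenideal f (y *m B) e.
Proof.
move=> Ig hh1 hh2 hg hy c0; exists (1 + 1)%N, (h1 * h2).
by rewrite hg hy; split=> //; apply: dhomogM.
Qed.

Hypotheses (al0 : al != 0) (ga0 : ga != 0) (be0 : be != 0).

Lemma eigenpoint_net_points (mm0 : mm != 0) (nn0 : nn != 0) (E0 : E != 0) y :
  y \in net_points -> eigenpoint f (y *m B).
Proof.
have n0 (x m n : F) : (row3 x m n == 0) = [&& x == 0, m == 0 & n == 0].
  apply/eqP/and3P => [e|[/eqP -> /eqP -> /eqP ->]]; last first.
    by apply/rowP => i; case: (ord3P i) => ->; rewrite row3E mxE.
  by split; apply/eqP; [rewrite -(row3_0 x m n)|rewrite -(row3_1 x m n)
    |rewrite -(row3_2 x m n)]; rewrite e mxE.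
rewrite !inE => hy; apply/eigenpoint_net; move: hy.
do ![case/orP]; move=> /eqP ->; rewrite !row3E n0 ?oner_eq0 ?mulf_eq0;
  rewrite ?(negPf al0) ?(negPf be0) ?(negPf ga0) ?(negPf mm0) ?(negPf nn0) ?(negPf E0);
  rewrite ?andbF //; split=> //; rewrite /E /mm /nn; ring.
Qed.

Ltac net_comb0 := rewrite /net1 /net2 /net3 /net_form1 /net_form2 /net_form3 /mm /nn; ring.
Ltac net_comb := let j := fresh in move=> j; case: (ord3P j) => ->;
  rewrite !row3E /net_form1 /net_form2 /net_form3 /E /mm /nn; ring.
Ltac net_eval := rewrite /net_form1 /net_form2 /net_form3 !evalE !meval_coord_frame
  !row3E /E /mm /nn; ring.

(** At each point two linear forms that cut it out are factors of two generators whose other factors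
    are nonzero there. The values [c] of those other factors are, up to sign, products of [al],
    [ga], [be], [mm], [nn] and [E], which is why these must not vanish. *)
Lemma reduced_net (mm0 : mm != 0) (nn0 : nn != 0) (E0 : E != 0) y :
  y \in net_points ->
  forall d (g : {mpoly F[3]}) n, g \is d.-homog ->
    local_eigenideal f (y *m B) (g ^+ n) -> local_eigenideal f (y *m B) g.
Proof.
move=> hy; have ev := eigenpoint_net_points mm0 nn0 E0 hy.
have [I1 I2 I3 _] := span.
have c0 := coord_homog 0; have c1 := coord_homog 1; have c2 := coord_homog 2.
have f1 := net_form1_homog; have f2 := net_form2_homog; have f3 := net_form3_homog.
move: hy ev; rewrite !inE.
do ![case/orP]; move=> /eqP -> ev.
- apply: (@reduced_net_at 1 _ (row3 0 1 0) (row3 0 0 1) (frame_coord B 0) (frame_coord B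
    1) (frame_coord B 2)) => //.
  + exact: oner_neq0.
  + by net_comb.
  + apply: (local_net (c := - be) I1 c0 f1); [by net_comb0 | by net_eval |].
    by rewrite ?oppr_eq0 ?mulf_neq0.
  + apply: (local_net (c := - be) I2 c0 f2); [by net_comb0 | by net_eval |].
    by rewrite ?oppr_eq0 ?mulf_neq0.
- apply: (@reduced_net_at 1 _ (row3 1 0 0) (row3 0 0 1) (frame_coord B 1) (frame_coord B
    0) (frame_coord B 2)) => //.
  + exact: oner_neq0.
  + by net_comb.
  + apply: (local_net (c := al) I1 c1 f1); [by net_comb0 | by net_eval |].
    by rewrite ?oppr_eq0 ?mulf_neq0.
  + apply: (local_net (c := - nn) I3 c1 f3); [by net_comb0 | by net_eval |].
    by rewrite ?oppr_eq0 ?mulf_neq0.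
- apply: (@reduced_net_at be _ (row3 (-1) 0 0) (row3 U 0 be) (frame_coord B 1) net_form1
    (frame_coord B 2)) => //.
  + by net_comb.
  + apply: (local_net (c := al * be) I1 c0 c1); [by net_comb0 | by net_eval |].
    by rewrite ?oppr_eq0 ?mulf_neq0.
  + apply: (local_net (c := - (be * be * nn)) I3 c1 f3); [by net_comb0 | by net_eval |].
    by rewrite ?oppr_eq0 ?mulf_neq0.
- apply: (@reduced_net_at 1 _ (row3 1 0 0) (row3 0 1 0) (frame_coord B 2) (frame_coord B
    0) (frame_coord B 1)) => //.
  + exact: oner_neq0.
  + by net_comb.
  + apply: (local_net (c := ga) I2 c2 f2); [by net_comb0 | by net_eval |].
    by rewrite ?oppr_eq0 ?mulf_neq0.
  + apply: (local_net (c := mm) I3 c2 f3); [by net_comb0 | by net_eval |].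
    by rewrite ?oppr_eq0 ?mulf_neq0.
- apply: (@reduced_net_at be _ (row3 (-1) 0 0) (row3 W be 0) (frame_coord B 2) net_form2
    (frame_coord B 1)) => //.
  + by net_comb.
  + apply: (local_net (c := ga * be) I2 c0 c2); [by net_comb0 | by net_eval |].
    by rewrite ?oppr_eq0 ?mulf_neq0.
  + apply: (local_net (c := be * be * mm) I3 c2 f3); [by net_comb0 | by net_eval |].
    by rewrite ?oppr_eq0 ?mulf_neq0.
- apply: (@reduced_net_at mm _ (row3 mm 0 0) (row3 0 0 1) (frame_coord B 1) (frame_coord
    B 0) net_form3) => //.
  + by net_comb.
  + apply: (local_net (c := mm * E) I1 c1 f1); [by net_comb0 | by net_eval |].
    by rewrite ?oppr_eq0 ?mulf_neq0.
  + apply: (local_net (c := mm * nn) I3 c1 c2); [by net_comb0 | by net_eval |].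
    by rewrite ?oppr_eq0 ?mulf_neq0.
- apply: (@reduced_net_at (be * mm) _ (row3 (- mm) 0 0) (row3 U 0 be) (frame_coord B 1)
    net_form1 net_form3) => //.
  + by rewrite ?oppr_eq0 ?mulf_neq0.
  + by net_comb.
  + apply: (local_net (c := E * (be * mm)) I1 c0 c1); [by net_comb0 | by net_eval |].
    by rewrite ?oppr_eq0 ?mulf_neq0.
  + apply: (local_net (c := be * mm * (be * nn)) I3 c1 c2); [by net_comb0 | by net_eval |].
    by rewrite ?oppr_eq0 ?mulf_neq0.
Qed.

Lemma net_points_complete (mm0 : mm != 0) (y : 'rV[F]_3) :
  eigenpoint f (y *m B) -> exists2 z, z \in net_points & exists k, y = k *: z.
Proof.
move=> /eigenpoint_net[_ e1 e2 e3]; move: e1 e2 e3; rewrite (row3P y) !row3E.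
move: (y 0 0) (y 0 1) (y 0 2) => x m n.
have [->|x0] := eqVneq x 0.
  move=> _ _ /eqP; rewrite !mulf_eq0 subr_eq0 -orbA => /or3P[] /eqP e3.
  - exists (row3 0 0 1); first by rewrite !inE eqxx ?orbT.
    by exists n; rewrite scale_row3 e3; congr row3; ring.
  - exists (row3 0 1 0); first by rewrite !inE eqxx ?orbT.
    by exists m; rewrite scale_row3 e3; congr row3; ring.
  - exists (row3 0 mm nn); first by rewrite !inE eqxx ?orbT.
    exists (m / mm); rewrite scale_row3; congr row3; rewrite ?mulr0 ?divfK //.
    by rewrite mulrAC [m * nn]mulrC -e3 mulrAC divff // mul1r.
have [->|m0] := eqVneq m 0.
  move=> _ /eqP e2 _; move: e2; rewrite !mulf_eq0 (negPf x0) mulr0 addr0 subr_eq0 /=.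
  move=> /orP[] /eqP e2.
    exists (row3 1 0 0); first by rewrite !inE eqxx ?orbT.
    by exists x; rewrite scale_row3 e2; congr row3; ring.
  exists (row3 ga 0 be); first by rewrite !inE eqxx ?orbT.
  exists (x / ga); rewrite scale_row3; congr row3; rewrite ?mulr0 ?divfK //.
  by rewrite mulrAC [x * be]mulrC -e2 mulrAC divff // mul1r.
(* Off the lines x = 0 and m = 0 the first equation says that [net_form1] vanishes, and the third
   leaves n = 0, which gives P3, or [net_form3] = 0, which gives P7. *)
move=> /eqP e1 _ /eqP; move: e1; rewrite !mulf_eq0 (negPf x0) (negPf m0) !subr_eq0 /=.
move=> /eqP e1 /orP[] /eqP e3.
  exists (row3 al be 0); first by rewrite !inE eqxx ?orbT.
  exists (x / al); rewrite scale_row3; congr row3; rewrite ?mulr0 ?divfK //.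
  move: e1; rewrite e3 mulr0 addr0 => e1.
  by rewrite mulrAC [x * be]mulrC -e1 mulrAC divff // mul1r.
exists (row3 E (be * mm) (be * nn)); first by rewrite !inE eqxx ?orbT.
have hn : n = nn * m / mm by rewrite -e3 mulrC mulKf.
have hx : x = (al * m + U * n) / be by rewrite e1 mulrC mulKf.
exists (m / (be * mm)); rewrite scale_row3; congr row3; rewrite ?hx ?hn ?/E; field;
  by rewrite ?be0 ?mm0.
Qed.

Lemma net_tangent w (y : 'rV[F]_3) d e (g h : {mpoly F[3]}) n :
  eigenscheme_reduced f -> eigenpoint f (y *m B) ->
  (dir_deriv w net1).@[(y *m B) 0] = 0 -> (dir_deriv w net2).@[(y *m B) 0] = 0 ->
  (dir_deriv w net3).@[(y *m B) 0] = 0 ->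
  g \is d.-homog -> h \is e.-homog -> h.@[(y *m B) 0] != 0 ->
  eigenideal f (h * g ^+ n) -> (dir_deriv w g).@[(y *m B) 0] = 0.
Proof.
move=> red ev t1 t2 t3; apply: (reduced_tangent uB red ev) => k l.
have [_ _ _ V] := span; have [c1 [c2 [c3 ->]]] := V k l.
move: net1 net2 net3 t1 t2 t3 => N1 N2 N3 t1 t2 t3.
by rewrite !dir_derivD !dir_derivCM !mevalD !mevalM t1 t2 t3 !mulr0 !addr0.
Qed.

Let dir_derivE := (dir_derivM, dir_derivB, dir_derivD, dir_derivC).

(* If nn = 0, the ideal contains a multiple of n^2 near P2, but P2 P4 is a
   tangent direction there: P6 has collided with P2. *)
Lemma reduced_net_nn : eigenscheme_reduced f -> mm != 0 -> nn != 0.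
Proof.
move=> red mm0; apply/eqP => nn0.
have ev : eigenpoint f (row3 0 1 0 *m B).
  apply/eigenpoint_net; rewrite !row3E; split; try ring.
  by apply/eqP => /rowP/(_ 1); rewrite row3E mxE; apply/eqP/oner_neq0.
have [_ _ I3 _] := span.
have /eqP : (dir_deriv (row 2 B) (frame_coord B 2)).@[(row3 0 1 0 *m B) 0] = 0.
  apply: (@net_tangent _ _ 1 1 _ (mm%:MP * frame_coord B 1) 2 red ev).
  1-3: rewrite /net1 /net2 /net3 /net_form1 /net_form2 /net_form3 !dir_derivE
      !dir_deriv_coord //.
  1-3: rewrite !evalE !meval_coord_frame !row3E /= ?nn0; rewrite ?meval1 ?meval0; ring.
  - exact: coord_homog.
  - by rewrite mul_mpolyC dhomogZ // coord_homog.
  - by rewrite !evalE meval_coord_frame row3E mulr1.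
  - suff -> : mm%:MP * frame_coord B 1 * frame_coord B 2 ^+ 2 = net3 by [].
    by rewrite /net3 /net_form3 nn0 mpolyC0; ring.
by rewrite dir_deriv_coord // meval1 oner_eq0.
Qed.

(** The mirror image at P4: with mm = 0 the generator [net3] is a multiple of m^2 n, and P6 has
    collided with P4. *)
Lemma reduced_net_mm : eigenscheme_reduced f -> nn != 0 -> mm != 0.
Proof.
move=> red nn0; apply/eqP => mm0.
have ev : eigenpoint f (row3 0 0 1 *m B).
  apply/eigenpoint_net; rewrite !row3E; split; try ring.
  by apply/eqP => /rowP/(_ 2); rewrite row3E mxE; apply/eqP/oner_neq0.
have [_ _ I3 _] := span.
have /eqP : (dir_deriv (row 1 B) (frame_coord B 1)).@[(row3 0 0 1 *m B) 0] = 0.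
  apply: (@net_tangent _ _ 1 1 _ ((- nn)%:MP * frame_coord B 2) 2 red ev).
  1-3: rewrite /net1 /net2 /net3 /net_form1 /net_form2 /net_form3 !dir_derivE
      !dir_deriv_coord //.
  1-3: rewrite !evalE !meval_coord_frame !row3E /= ?mm0; rewrite ?meval1 ?meval0; ring.
  - exact: coord_homog.
  - by rewrite mul_mpolyC dhomogZ // coord_homog.
  - by rewrite !evalE meval_coord_frame row3E mulr1 oppr_eq0.
  - suff -> : (- nn)%:MP * frame_coord B 2 * frame_coord B 1 ^+ 2 = net3 by [].
    by rewrite /net3 /net_form3 mm0 mpolyC0; ring.
by rewrite dir_deriv_coord // meval1 oner_eq0.
Qed.

(* If E = 0, then x^2 is in the ideal near P6 and P6 P1 is a tangent direction:
   P7 has collided with P6. *)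
Lemma reduced_net_E : eigenscheme_reduced f -> mm != 0 -> nn != 0 -> E != 0.
Proof.
move=> red mm0 nn0; apply/eqP => E0.
have ev : eigenpoint f (row3 0 mm nn *m B).
  apply/eigenpoint_net; rewrite !row3E; split; try ring.
  by apply/eqP => /rowP/(_ 1); rewrite row3E mxE; apply/eqP.
have [I1 _ I3 _] := span.
have /eqP : (dir_deriv (row 0 B) (frame_coord B 0)).@[(row3 0 mm nn *m B) 0] = 0.
  apply: (@net_tangent _ _ 1 (1 + 1) _ ((mm * be)%:MP * frame_coord B 1 * frame_coord B
      2) 2 red ev).
  1-3: rewrite /net1 /net2 /net3 /net_form1 /net_form2 /net_form3 !dir_derivE
      !dir_deriv_coord //.
  1-3: rewrite !evalE !meval_coord_frame !row3E /=; rewrite ?meval1 ?meval0.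
  - by transitivity (mm * E); [rewrite /E; ring | rewrite E0 mulr0].
  - by transitivity (nn * E); [rewrite /E /mm /nn; ring | rewrite E0 mulr0].
  - ring.
  - exact: coord_homog.
  - rewrite -mulrA mul_mpolyC dhomogZ //; apply: dhomogM; exact: coord_homog.
  - by rewrite !evalE !meval_coord_frame !row3E !mulf_neq0.
  (* In the combination U x [net3] - mm n [net1] the terms in x m n^2 cancel. What is left is mm be
     x^2 m n - E x m^2 n, and E = 0. *)
  - suff -> : (mm * be)%:MP * frame_coord B 1 * frame_coord B 2 * frame_coord B 0 ^+ 2
        = (U%:MP * frame_coord B 0) * net3 + (- (mm%:MP * frame_coord B 2)) * net1.
      by apply: eigenidealD; apply: eigenidealM.
    transitivity ((U%:MP * frame_coord B 0) * net3 + (- (mm%:MP * frame_coord B 2)) * net1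
      + E%:MP * frame_coord B 0 * frame_coord B 1 ^+ 2 * frame_coord B 2).
      by rewrite /net1 /net3 /net_form1 /net_form3 /E; ring.
    by rewrite E0 mpolyC0 !mul0r addr0.
by rewrite dir_deriv_coord // meval1 oner_eq0.
Qed.

(** mm = 0, nn = 0 and E = 0 are the collisions of P6 with P4, of P6 with P2 and of P7 with P6. *)
Definition net_general := [/\ mm != 0, nn != 0 & E != 0].

(** The disjunction says that [net_form3] is not zero; then each of mm and nn is nonzero as soon as
    the other one is. *)
Lemma reduced_net_general :
  eigenscheme_reduced f -> (mm != 0) || (nn != 0) -> net_general.
Proof.
move=> red mn.
have mm0 : mm != 0 by case/orP: mn => //; apply: reduced_net_mm.
have nn0 := reduced_net_nn red mm0.
by split=> //; apply: reduced_net_E.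
Qed.

Lemma net_eigenpoints : net_general -> eigenscheme_reduced f /\
  forall v, eigenpoint f v <->
    exists2 z, z \in net_points & exists2 k, k != 0 & v = k *: (z *m B).
Proof.
move=> [mm0 nn0 E0].
have ev v : eigenpoint f v ->
    exists2 z, z \in net_points & exists2 k, k != 0 & v = k *: (z *m B).
  move=> evv; have [v0 _] := evv; move: evv v0; rewrite -{1 2 3}(mulmxKV uB v).
  move=> /(net_points_complete mm0) [z hz [k hk]]; rewrite hk -scalemxAl => v0.
  exists z => //; exists k => //; apply: contraNneq v0 => ->.
  by rewrite scale0r.
split=> [v /ev [z hz [k k0 ->]] d g n hg [e [h [hh hv Ih]]]|v].
  apply: local_eigenidealZ => //; apply: (reduced_net mm0 nn0 E0 hz hg (n := n)).
  exists e, h; split=> //; move: hv.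
  by rewrite (meval_homogZ _ _ hh) mulf_eq0 negb_or => /andP[].
split=> [|[z hz [k k0 ->]]]; first exact: ev.
exact/eigenpointZ/eigenpoint_net_points.
Qed.
End Net.

(** * The bilinear form, and cubic forms in a frame *)

Lemma dotE (F : fieldType) (u v : 'rV[F]_3) :
  dot u v = u 0 0 * v 0 0 + u 0 1 * v 0 1 + u 0 2 * v 0 2.
Proof. exact: sum3E. Qed.

Lemma crossE (F : fieldType) (u v : 'rV[F]_3) :
  cross u v = row3 (u 0 1 * v 0 2 - u 0 2 * v 0 1)
    (u 0 2 * v 0 0 - u 0 0 * v 0 2) (u 0 0 * v 0 1 - u 0 1 * v 0 0).
Proof.
have e (i j : 'I_3) : val i = val j -> i = j by exact: val_inj.
apply/rowP => k; rewrite !mxE; case: (ord3P k) => ->.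
- by rewrite (e (0 + 1) 1) // (e (0 + 2) 2).
- by rewrite (e (1 + 1) 2) // (e (1 + 2) 0).
- by rewrite (e (2 + 1) 0) // (e (2 + 2) 1).
Qed.

Section Dot.
Variable F : fieldType.
Implicit Types u v w : 'rV[F]_3.
Lemma dotC u v : dot u v = dot v u.
Proof. by rewrite !dotE; ring. Qed.
Lemma dotDl u v w : dot (u + v) w = dot u w + dot v w.
Proof. by rewrite !dotE !mxE; ring. Qed.
Lemma dotZl k u v : dot (k *: u) v = k * dot u v.
Proof. by rewrite !dotE !mxE; ring. Qed.
Lemma dotDr u v w : dot u (v + w) = dot u v + dot u w.
Proof. by rewrite !dotE !mxE; ring. Qed.
Lemma dotZr k u v : dot u (k *: v) = k * dot u v.
Proof. by rewrite !dotE !mxE; ring. Qed.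
Lemma dot_cross_l u v : dot (cross u v) u = 0.
Proof. by rewrite crossE !dotE !row3E; ring. Qed.
Lemma dot_cross_r u v : dot (cross u v) v = 0.
Proof. by rewrite crossE !dotE !row3E; ring. Qed.
Lemma dot_cross_cross u v :
  dot (cross u v) (cross u v) = dot u u * dot v v - dot u v ^+ 2.
Proof. by rewrite crossE !dotE !row3E; ring. Qed.
End Dot.

(** Euler's identity, applied three times, expresses 6 f through the third derivatives of f along
    the frame. These are constants, and t is a sixth of them; the coefficients 3 and 6 count the
    orders of differentiation. *)
Lemma cubic_coords (F : numFieldType) (f : {mpoly F[3]}) (B : 'M[F]_3) :
  let x := frame_coord B 0 in let m := frame_coord B 1 in let n := frame_coord B 2 in
  B \in unitmx -> f \is 3.-homog ->
  exists t : 'I_3 -> 'I_3 -> 'I_3 -> F,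
    f = (t 0 0 0)%:MP * x ^+ 3 + (t 1 1 1)%:MP * m ^+ 3 + (t 2 2 2)%:MP * n ^+ 3
      + 3 * ((t 0 0 1)%:MP * x ^+ 2 * m + (t 0 0 2)%:MP * x ^+ 2 * n
      + (t 0 1 1)%:MP * x * m ^+ 2 + (t 0 2 2)%:MP * x * n ^+ 2
      + (t 1 1 2)%:MP * m ^+ 2 * n + (t 1 2 2)%:MP * m * n ^+ 2)
      + 6 * (t 0 1 2)%:MP * x * m * n.
Proof.
move=> x m n uB hf.
have eul d (p : {mpoly F[3]}) : p \is d.-homog ->
    p *+ d = x * dir_deriv (row 0 B) p + m * dir_deriv (row 1 B) p + n * dir_deriv (row 2 B) p.
  move=> /euler <-; under eq_bigr => i _ do rewrite (var_coord i uB).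
  rewrite !sum3E /dir_deriv !sum3E !mxE -/x -/m -/n; ring.
pose D k := dir_deriv (row k B).
have hc k j i : exists c : F, D k (D j (D i f)) = c%:MP.
  exists (D k (D j (D i f)))@_0; apply: msize1_polyC; rewrite msizeE.
  apply/bigmax_leqP_seq => q hq _.
  have /dhomogP/(_ q hq) /= -> // : D k (D j (D i f)) \is 0.-homog.
  by rewrite !dir_deriv_homog.
have [t ht] : exists t, forall k j i, D k (D j (D i f)) = (t k j i)%:MP * 6.
  exists (fun k j i => (D k (D j (D i f)))@_0 / 6) => k j i.
  have [c ->] := hc k j i; rewrite mcoeffC eqxx mulr1.
  transitivity ((c / 6 * 6)%:MP_[3] : {mpoly F[3]}); last by rewrite mpolyCM; ring.
  by rewrite divfK // pnatr_eq0.
exists t.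
have E3 : f *+ 3 = x * D 0 f + m * D 1 f + n * D 2 f by apply: eul.
have E2 i : D i f *+ 2 = x * D 0 (D i f) + m * D 1 (D i f) + n * D 2 (D i f).
  by apply: eul; apply: dir_deriv_homog.
have E1 j i : D j (D i f)
    = x * D 0 (D j (D i f)) + m * D 1 (D j (D i f)) + n * D 2 (D j (D i f)).
  by rewrite -[LHS]mulr1n; apply: eul; do 2!apply: dir_deriv_homog.
have six0 (p q : {mpoly F[3]}) : p *+ 6 = q *+ 6 -> p = q.
  move=> h; have k6 : (6^-1 : F) *+ 6 = 1 by rewrite -[LHS]mulr_natr mulVf ?pnatr_eq0.
  have k1 (s : {mpoly F[3]}) : s = (6^-1)%:MP * (s *+ 6).
    by rewrite mulrnAr -mulrnAl -mpolyCMn k6 mpolyC1 mul1r.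
  by rewrite [p]k1 h -k1.
apply: six0.
(* Derivatives commute, which reduces the 27 third derivatives to the ten with sorted indices. *)
have cm i j k : D i (D j (D k f)) = D j (D i (D k f)) by apply: dir_deriv_comm.
have cm' i j k : D i (D j (D k f)) = D i (D k (D j f)) by rewrite /D [dir_deriv (row j B)
    _]dir_deriv_comm.
transitivity (x * (D 0 f *+ 2) + m * (D 1 f *+ 2) + n * (D 2 f *+ 2)).
  by rewrite (mulrnA f 3 2) E3; ring.
rewrite !E2 (E1 0 0) (E1 1 0) (E1 2 0) (E1 0 1) (E1 1 1) (E1 2 1).
rewrite (E1 0 2) (E1 1 2) (E1 2 2).
clear E1 E2 E3 hc; clearbody D x m n.
rewrite (cm' 1 1 0) (cm' 2 2 0) (cm 2 1 1) (cm' 2 2 1) (cm' 2 1 0) (cm' 1 2 0).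
rewrite (cm 1 0 0) (cm 2 0 0) (cm' 0 1 0) (cm' 0 2 0) (cm 1 0 1) (cm 2 0 2).
rewrite (cm' 1 2 1) (cm 2 1 2) (cm 2 0 1) (cm' 0 2 1) (cm 1 0 2) !ht; ring.
Qed.

Lemma dir_deriv_cubic_eval (F : numFieldType) (t : 'I_3 -> 'I_3 -> 'I_3 -> F)
    (f x m n : {mpoly F[3]}) (u : 'rV[F]_3) (v : 'I_3 -> F) (dx dm dn : F) :
  f = (t 0 0 0)%:MP * x ^+ 3 + (t 1 1 1)%:MP * m ^+ 3 + (t 2 2 2)%:MP * n ^+ 3
    + 3 * ((t 0 0 1)%:MP * x ^+ 2 * m + (t 0 0 2)%:MP * x ^+ 2 * n
    + (t 0 1 1)%:MP * x * m ^+ 2 + (t 0 2 2)%:MP * x * n ^+ 2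
    + (t 1 1 2)%:MP * m ^+ 2 * n + (t 1 2 2)%:MP * m * n ^+ 2)
    + 6 * (t 0 1 2)%:MP * x * m * n ->
  dir_deriv u x = dx%:MP -> dir_deriv u m = dm%:MP -> dir_deriv u n = dn%:MP ->
  (dir_deriv u f).@[v] = let X := x.@[v] in let M := m.@[v] in let N := n.@[v] in
    3 * (dx * (t 0 0 0 * X ^+ 2 + 2 * t 0 0 1 * X * M + 2 * t 0 0 2 * X * N
      + t 0 1 1 * M ^+ 2 + t 0 2 2 * N ^+ 2 + 2 * t 0 1 2 * M * N)
    + dm * (t 1 1 1 * M ^+ 2 + t 0 0 1 * X ^+ 2 + 2 * t 0 1 1 * X * M
      + 2 * t 1 1 2 * M * N + t 1 2 2 * N ^+ 2 + 2 * t 0 1 2 * X * N)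
    + dn * (t 2 2 2 * N ^+ 2 + t 0 0 2 * X ^+ 2 + 2 * t 0 2 2 * X * N
      + t 1 1 2 * M ^+ 2 + 2 * t 1 2 2 * M * N + 2 * t 0 1 2 * X * M)).
Proof.
move=> -> ex em en; rewrite !(dir_derivM, dir_derivD, dir_derivC, dir_derivX,
    dir_deriv_nat) ex em en.
rewrite !(mevalM, mevalD, mevalC, mevalMn, rmorphXn, rmorph_nat, meval0) /=; ring.
Qed.

(** Derives one equation from another: the remaining goal is a polynomial identity that [ring] can
    check. *)
Lemma lin_eq (V : zmodType) (u v w z : V) : u = v -> w - z = u - v -> w = z.
Proof. by move=> ->; rewrite subrr => /eqP; rewrite subr_eq0 => /eqP. Qed.

(* The t's are the coefficients of a cubic form in the frame P1, P2, P4 and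
   sys X M N says that the point with coordinates (X, M, N) is an eigenpoint. *)
Lemma tensor_normal_form (F : numFieldType) (s11 s22 s24 s44 a b c d : F)
    (t000 t111 t222 t001 t002 t011 t022 t112 t122 t012 : F) :
  s11 != 0 -> s22 * s44 - s24 ^+ 2 != 0 -> a != 0 -> b != 0 -> c != 0 -> d != 0 ->
  s22 != 0 \/ s44 != 0 ->
  let sys X M N :=
    let q0 := t000 * X ^+ 2 + 2 * t001 * X * M + 2 * t002 * X * N
      + t011 * M ^+ 2 + t022 * N ^+ 2 + 2 * t012 * M * N in
    let q1 := t111 * M ^+ 2 + t001 * X ^+ 2 + 2 * t011 * X * M
      + 2 * t112 * M * N + t122 * N ^+ 2 + 2 * t012 * X * N in
    let q2 := t222 * N ^+ 2 + t002 * X ^+ 2 + 2 * t022 * X * N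
      + t112 * M ^+ 2 + 2 * t122 * M * N + 2 * t012 * X * M in
    [/\ s11 * X * q1 = (s22 * M + s24 * N) * q0,
      s11 * X * q2 = (s24 * M + s44 * N) * q0
    & (s22 * M + s24 * N) * q2 = (s24 * M + s44 * N) * q1] in
  sys 1 0 0 -> sys 0 1 0 -> sys a b 0 -> sys 0 0 1 -> sys c 0 d ->
  let k := t000 / (s11 * b * d) in
  [/\ [/\ t001 = 0, t002 = 0, t011 = 0, t022 = 0 & t012 = 0],
    t111 = k * (a * d) * s22, t112 = k * (a * d) * s24,
    t122 = k * (b * c) * s24 & t222 = k * (b * c) * s44].
Proof.
move=> s1 dt a0 b0 c0 d0 iso sys [p11 p12 p13] [p21 p22 p23] [p31 p32 p33]
  [p41 p42 p43] [p51 p52 p53] k.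
have can (u v : F) : u != 0 -> u * v = 0 -> v = 0.
  by move=> u0 /eqP; rewrite mulf_eq0 (negPf u0) => /eqP.
have h001 : t001 = 0 by apply: (can s11) => //; apply: (lin_eq p11); ring.
have h002 : t002 = 0 by apply: (can s11) => //; apply: (lin_eq p12); ring.
(* The two equations at P2 say that the row (s22, s24) of the Gram matrix is killed by t011; the
   determinant is a combination of that row, so t011 = 0. The same works at P4 for t022. *)
have h011 : t011 = 0.
  have u1 : s22 * t011 = 0 by apply/esym/(lin_eq p21); ring.
  have u2 : s24 * t011 = 0 by apply/esym/(lin_eq p22); ring.
  apply: (can _ _ dt); transitivity (s44 * (s22 * t011) - s24 * (s24 * t011)); first by ring.
  by rewrite u1 u2; ring.
have h022 : t022 = 0.
  have u1 : s24 * t022 = 0 by apply/esym/(lin_eq p41); ring.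
  have u2 : s44 * t022 = 0 by apply/esym/(lin_eq p42); ring.
  apply: (can _ _ dt); transitivity (s22 * (s44 * t022) - s24 * (s24 * t022)); first by ring.
  by rewrite u1 u2; ring.
subst t001 t002 t011 t022.
have c2 : s22 * t112 = s24 * t111 by apply: (lin_eq p23); ring.
have c4 : s24 * t222 = s44 * t122 by apply: (lin_eq p43); ring.
have two0 : 2 != 0 :> F by rewrite pnatr_eq0.
(* P2 and P3 together give s22 t012 = 0, and P4 and P5 give s44 t012 = 0. So the coefficient of x m
   n is killed when P2 or P4 is not isotropic. *)
have h012 : t012 = 0.
  have w1 : s22 * t012 = 0.
    apply: (can (2 * a * b * b)); first by rewrite !mulf_neq0.
    transitivity (2 * a * b * b * (s22 * t012) + b ^+ 3 * (s22 * t112) - b ^+ 3 * (s24 *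
        t111)).
      by rewrite c2; ring.
    by apply: (lin_eq p33); ring.
  have w2 : s44 * t012 = 0.
    apply: (can (2 * c * d * d)); first by rewrite !mulf_neq0.
    transitivity (2 * c * d * d * (s44 * t012) + d ^+ 3 * (s44 * t122) - d ^+ 3 * (s24 *
        t222)).
      by rewrite c4; ring.
    by apply/esym/(lin_eq p53); ring.
  by case: iso => /can; apply.
subst t012.
have kE : t000 = k * (s11 * b * d) by rewrite /k divfK // !mulf_neq0.
have canl (u v w : F) : u != 0 -> u * v = u * w -> v = w by move=> /mulfI; apply.
clearbody k; subst t000; split=> //.
- by apply: (canl (s11 * a * b * b)); rewrite ?mulf_neq0 //; apply: (lin_eq p31); ring.
- by apply: (canl (s11 * a * b * b)); rewrite ?mulf_neq0 //; apply: (lin_eq p32); ring.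
- by apply: (canl (s11 * c * d * d)); rewrite ?mulf_neq0 //; apply: (lin_eq p51); ring.
- by apply: (canl (s11 * c * d * d)); rewrite ?mulf_neq0 //; apply: (lin_eq p52); ring.
Qed.

(** * V-configurations with P1 = P2 x P4 *)

Section Configuration.
Variable F : numFieldType.
Variables (p r : 'rV[F]_3) (l a b c d : F).

Let e0 := l *: cross p r.
Let s22 := dot p p.
Let s24 := dot p r.
Let s44 := dot r r.
Let D := s22 * s44 - s24 ^+ 2.
Let s11 := l ^+ 2 * D.

Definition gram_det := D.
(** Chosen so that (al, be, 0) = D d (a, b, 0) and (ga, 0, be) = D b (c, 0, d) are the frame
    coordinates of P3 and P5. U and W are the mixed coefficients that arise in [vcubic_span]. *)
Definition vconf_al := D * (a * d).
Definition vconf_ga := D * (b * c).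
Definition vconf_be := D * (b * d).
Definition vconf_U := 2 * s24 * (a * d * s44 - b * c * s24).
Definition vconf_W := 2 * s24 * (b * c * s22 - a * d * s24).

Definition frame : 'M[F]_3 := \matrix_(k < 3) [:: e0; p; r]`_k.

Definition vconf : 'M[F]_(5, 3) :=
  \matrix_(k < 5) [:: e0; p; b *: p + a *: e0; r; d *: r + c *: e0]`_k.

Lemma row_frame0 : row 0 frame = e0. Proof. by rewrite rowK. Qed.
Lemma row_frame1 : row 1 frame = p. Proof. by rewrite rowK. Qed.
Lemma row_frame2 : row 2 frame = r. Proof. by rewrite rowK. Qed.
Definition row_frame := (row_frame0, row_frame1, row_frame2).

Lemma dot00 : dot e0 e0 = s11.
Proof. by rewrite dotZl dotZr dot_cross_cross mulrA. Qed.
Lemma dot0p : dot e0 p = 0. Proof. by rewrite dotZl dot_cross_l mulr0. Qed.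
Lemma dot0r : dot e0 r = 0. Proof. by rewrite dotZl dot_cross_r mulr0. Qed.
Lemma dotp0 : dot p e0 = 0. Proof. by rewrite dotC dot0p. Qed.
Lemma dotr0 : dot r e0 = 0. Proof. by rewrite dotC dot0r. Qed.
Lemma dotrp : dot r p = s24. Proof. exact: dotC. Qed.
Definition dotf := (dot00, dot0p, dot0r, dotp0, dotr0, dotrp).

Lemma row3_frame x m n : row3 x m n *m frame = x *: e0 + m *: p + n *: r.
Proof.
by rewrite mulmx_sum_row sum3E !row3E !row_frame.
Qed.

Hypotheses (l0 : l != 0) (D0 : D != 0).

Lemma s110 : s11 != 0. Proof. by rewrite mulf_neq0 ?expf_neq0. Qed.

Lemma pt_vconf : [/\ pt vconf 1 = e0, pt vconf 2 = p, pt vconf 3 = b *: p + a *: e0,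
  pt vconf 4 = r & pt vconf 5 = d *: r + c *: e0].
Proof. by split; rewrite /pt rowK inordK. Qed.

Let mm := vconf_ga - vconf_U.
Let nn := vconf_al - vconf_W.
Let E := vconf_al * mm + vconf_U * nn.

Lemma point6_vconf : point6 vconf = s11 *: (mm *: p + nn *: r).
Proof.
have [P1 P2 P3 P4 P5] := pt_vconf; rewrite /point6 P1 P2 P3 P4 P5.
(* Only the scalar products of [e0] matter, so the vector is generalised and its cross product is
   never expanded. *)
move: dot00 dot0p dot0r dotp0 dotr0 dotrp; move: (e0) => e ee ep er pe re rp.
rewrite !(dotDl, dotDr, dotZl, dotZr) ee ep er ?pe ?re ?rp -/s22 -/s24 -/s44.
rewrite [RHS]scalerDr !scalerA; congr (_ *: _ + _ *: _);
  by rewrite /mm /nn /vconf_al /vconf_ga /vconf_U /vconf_W /D; ring.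
Qed.

Lemma point7_vconf :
  point7 vconf = (s11 ^+ 3 * c * D) *: (E *: e0 + (vconf_be * mm) *: p + (vconf_be * nn) *: r).
Proof.
have [P1 P2 P3 P4 P5] := pt_vconf.
rewrite /point7 point6_vconf P1 P2 P4 P5.
move: dot00 dot0p dot0r dotp0 dotr0 dotrp; move: (e0) => e ee ep er pe re rp.
rewrite !(dotDl, dotDr, dotZl, dotZr) ee ep er ?pe ?re ?rp -/s22 -/s24 -/s44.
rewrite !scalerDr !scalerA addrA.
by congr (_ *: _ + _ *: _ + _ *: _);
  rewrite /E /vconf_be /mm /nn /vconf_al /vconf_ga /vconf_U /vconf_W /s11 /D; ring.
Qed.

(** The Gram matrix of the frame is block diagonal, with blocks of determinants [s11] and D. H is
    its explicit inverse, so [frame^T *m H] inverts the frame. *)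
Lemma frame_unit : frame \in unitmx.
Proof.
pose G := \matrix_(i, j) dot (row i frame) (row j frame).
have : frame *m frame^T = G.
  by apply/matrixP => i j; rewrite !mxE; apply: eq_bigr => k _; rewrite !mxE.
pose dt := s22 * s44 - s24 ^+ 2; have dt0 : dt != 0 by [].
pose H := \matrix_(i < 3) [:: row3 s11^-1 0 0; row3 0 (s44 / dt) (- s24 / dt);
                           row3 0 (- s24 / dt) (s22 / dt)]`_i.
have [H0 H1 H2] : [/\ row 0 H = row3 s11^-1 0 0,
    row 1 H = row3 0 (s44 / dt) (- s24 / dt) & row 2 H = row3 0 (- s24 / dt) (s22 / dt)].
  by split; rewrite rowK.
have hH i j : H i j = row i H 0 j by rewrite [RHS]mxE.
have hGE i j : G i j = dot (row i frame) (row j frame) by rewrite mxE.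
move=> hG; suff : frame *m (frame^T *m H) = 1%:M by case/mulmx1_unit.
rewrite mulmxA hG; apply/matrixP => i j; rewrite [LHS]mxE [RHS]mxE sum3E !hGE !hH.
have s1 := s110; rewrite /dt in dt0.
by case: (ord3P i) => ->; case: (ord3P j) => ->; rewrite H0 H1 H2 !row3E !row_frame !dotf /=;
  rewrite -/s22 -/s24 -/s44 /dt; field; rewrite ?s1 ?dt0.
Qed.

Let B := frame.
Let x := frame_coord B 0.
Let m := frame_coord B 1.
Let n := frame_coord B 2.

Lemma lin_form_frame : [/\ lin_form e0 = s11%:MP * x, lin_form p = s22%:MP * m + s24%:MP * n
  & lin_form r = s24%:MP * m + s44%:MP * n].
Proof.
have uB := frame_unit.
by split; rewrite (lin_form_coord _ uB) sum3E !row_frame !dotf ?mpolyC0 -/x -/m -/n; ring.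
Qed.

(* If P2 or P4 is not isotropic, then the five eigenpoints force this form. *)
Definition vcubic k : {mpoly F[3]} :=
  k%:MP * ((s11 * b * d)%:MP * x ^+ 3
    + (a * d)%:MP * (s22%:MP * m ^+ 3 + (3 * s24)%:MP * m ^+ 2 * n)
    + (b * c)%:MP * ((3 * s24)%:MP * m * n ^+ 2 + s44%:MP * n ^+ 3)).

Lemma dir_deriv_frame_coord : 
  [/\ [/\ dir_deriv e0 x = 1, dir_deriv e0 m = 0 & dir_deriv e0 n = 0],
      [/\ dir_deriv p x = 0, dir_deriv p m = 1 & dir_deriv p n = 0]
    & [/\ dir_deriv r x = 0, dir_deriv r m = 0 & dir_deriv r n = 1]].
Proof.
have uB := frame_unit.
by split; split; rewrite -?row_frame0 -1?row_frame1 -?row_frame2 dir_deriv_coord.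
Qed.

Lemma dir_deriv_vcubic k :
  [/\ dir_deriv e0 (vcubic k) = (3 * k * s11 * b * d)%:MP * x ^+ 2,
      dir_deriv p (vcubic k) = (3 * k)%:MP * ((a * d)%:MP * (s22%:MP * m ^+ 2
        + (2 * s24)%:MP * m * n) + (b * c * s24)%:MP * n ^+ 2)
    & dir_deriv r (vcubic k) = (3 * k)%:MP * ((a * d * s24)%:MP * m ^+ 2
        + (b * c)%:MP * ((2 * s24)%:MP * m * n + s44%:MP * n ^+ 2))].
Proof.
have [[x0 m0 n0] [xp mp np] [xr mr nr]] := dir_deriv_frame_coord.
by rewrite /vcubic; split;
  rewrite !(dir_derivM, dir_derivD, dir_derivC, dir_derivX) ?x0 ?m0 ?n0 ?xp ?mp ?np ?xr
      ?mr ?nr; ring.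
Qed.

Lemma vcubic_homog k : vcubic k \is 3.-homog.
Proof.
have hX j e : frame_coord B j ^+ e \is e.-homog.
  by have := dhomogMn e (coord_homog B j); rewrite mul1n.
have hM (i j : 'I_3) : frame_coord B i ^+ 2 * frame_coord B j \is 3.-homog.
  by apply: (@dhomogM _ _ _ 2 _ 1); [apply: hX | apply: coord_homog].
rewrite /vcubic mul_mpolyC dhomogZ // !rpredD //.
- by rewrite mul_mpolyC dhomogZ // hX.
- rewrite mul_mpolyC dhomogZ // rpredD //; first by rewrite mul_mpolyC dhomogZ // hX.
  by rewrite -mulrA mul_mpolyC dhomogZ // hM.
- rewrite mul_mpolyC dhomogZ // rpredD //; last by rewrite mul_mpolyC dhomogZ // hX.
  by rewrite -mulrA [m * _]mulrC mul_mpolyC dhomogZ // hM.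
Qed.

(** In [j1] and [j2] the adjugate of the Gram matrix of P2 and P4 is applied to the minors of (e0,
    p) and (e0, r). It turns [lin_form p] and [lin_form r] into multiples of m and n and cancels the
    term in n^2, respectively m^2, of the gradient, so that x m and x n factor out. [i1] and [i2]
    invert this up to the factor D. *)
Lemma vcubic_span k : k != 0 -> spanned_by_net (vcubic k) B vconf_al vconf_ga vconf_U
    vconf_W vconf_be.
Proof.
move=> k0; have [le lp lr] := lin_form_frame; have [de dp dr] := dir_deriv_vcubic k.
pose N1 := net1 B vconf_al vconf_U vconf_be; pose N2 := net2 B vconf_ga vconf_W vconf_be;
    pose N3 := net3 B vconf_al vconf_ga vconf_U vconf_W.
have i1 : D%:MP * contracted_minor (vcubic k) e0 p = (3 * k * s11)%:MP * (s22%:MP * N1 +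
    s24%:MP * N2).
  rewrite /contracted_minor le lp de dp /N1 /N2 /net1 /net2 /net_form1 /net_form2 -/x -/m -/n.
  by rewrite /vconf_al /vconf_ga /vconf_be /vconf_U /vconf_W /D; ring.
have i2 : D%:MP * contracted_minor (vcubic k) e0 r = (3 * k * s11)%:MP * (s24%:MP * N1 +
    s44%:MP * N2).
  rewrite /contracted_minor le lr de dr /N1 /N2 /net1 /net2 /net_form1 /net_form2 -/x -/m -/n.
  by rewrite /vconf_al /vconf_ga /vconf_be /vconf_U /vconf_W /D; ring.
have i3 : contracted_minor (vcubic k) p r = (3 * k)%:MP * N3.
  rewrite /contracted_minor lp lr dp dr /N3 /net3 /net_form3 -/x -/m -/n.
  by rewrite /vconf_al /vconf_ga /vconf_be /vconf_U /vconf_W /D; ring.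
have j1 : (3 * k * s11)%:MP * N1
    = s44%:MP * contracted_minor (vcubic k) e0 p + (- s24)%:MP * contracted_minor (vcubic
        k) e0 r.
  rewrite /contracted_minor le lp lr de dp dr /N1 /net1 /net_form1 -/x -/m -/n.
  by rewrite /vconf_al /vconf_ga /vconf_be /vconf_U /vconf_W /D; ring.
have j2 : (3 * k * s11)%:MP * N2
    = s22%:MP * contracted_minor (vcubic k) e0 r + (- s24)%:MP * contracted_minor (vcubic
        k) e0 p.
  rewrite /contracted_minor le lp lr de dp dr /N2 /net2 /net_form2 -/x -/m -/n.
  by rewrite /vconf_al /vconf_ga /vconf_be /vconf_U /vconf_W /D; ring.
have k3 : 3 * k != 0 by rewrite mulf_neq0 ?pnatr_eq0.
have k31 : 3 * k * s11 != 0 by rewrite mulf_neq0 ?s110.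
have canc (t : F) (g : {mpoly F[3]}) : t != 0 -> g = (t^-1)%:MP * (t%:MP * g).
  by move=> t0; rewrite mulrA -mpolyCM mulVf // mpolyC1 mul1r.
have W0p := canc _ (contracted_minor (vcubic k) e0 p) D0.
have W0r := canc _ (contracted_minor (vcubic k) e0 r) D0.
have vC u v : contracted_minor (vcubic k) u v = - contracted_minor (vcubic k) v u by
    rewrite /contracted_minor; ring.
have v0 u : contracted_minor (vcubic k) u u = 0 by rewrite /contracted_minor; ring.
split.
- rewrite -/N1 (canc _ N1 k31); apply: eigenidealM; rewrite j1.
  by apply: eigenidealD; apply: eigenidealM; apply: eigenideal_contracted_minor.
- rewrite -/N2 (canc _ N2 k31); apply: eigenidealM; rewrite j2.
  by apply: eigenidealD; apply: eigenidealM; apply: eigenideal_contracted_minor.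
- rewrite -/N3 (canc _ N3 k3); apply: eigenidealM; rewrite -i3.
  exact: eigenideal_contracted_minor.
rewrite -/N1 -/N2 -/N3.
have V u v : u \in [:: (e0, p); (e0, r); (p, r)] -> v = contracted_minor (vcubic k) u.1 u.2 ->
  exists c1 c2 c3 : F, v = c1%:MP * N1 + c2%:MP * N2 + c3%:MP * N3.
  rewrite !inE => /or3P[] /eqP -> ->.
  + exists (D^-1 * (3 * k * s11) * s22), (D^-1 * (3 * k * s11) * s24), 0.
    by rewrite W0p i1 mpolyC0; ring.
  + exists (D^-1 * (3 * k * s11) * s24), (D^-1 * (3 * k * s11) * s44), 0.
    by rewrite W0r i2 mpolyC0; ring.
  + exists 0, 0, (3 * k).
    by rewrite i3 mpolyC0; ring.
have VN u v : u \in [:: (e0, p); (e0, r); (p, r)] -> v = contracted_minor (vcubic k) u.2 u.1 ->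
  exists c1 c2 c3 : F, v = c1%:MP * N1 + c2%:MP * N2 + c3%:MP * N3.
  move=> hu ->; have [c1 [c2 [c3 Ev]]] := V u _ hu erefl.
  by exists (- c1), (- c2), (- c3); rewrite vC Ev; ring.
have V0 u : exists c1 c2 c3 : F,
    contracted_minor (vcubic k) u u = c1%:MP * N1 + c2%:MP * N2 + c3%:MP * N3.
  by exists 0, 0, 0; rewrite v0 !mpolyC0; ring.
move=> i j; case: (ord3P i) => ->; case: (ord3P j) => ->; rewrite !row_frame //.
- by apply: (V (e0, p)); rewrite ?inE ?eqxx ?orbT.
- by apply: (V (e0, r)); rewrite ?inE ?eqxx ?orbT.
- by apply: (VN (e0, p)); rewrite ?inE ?eqxx ?orbT.
- by apply: (V (p, r)); rewrite ?inE ?eqxx ?orbT.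
- by apply: (VN (e0, r)); rewrite ?inE ?eqxx ?orbT.
- by apply: (VN (p, r)); rewrite ?inE ?eqxx ?orbT.
Qed.

Hypotheses (a0 : a != 0) (b0 : b != 0) (c0 : c != 0) (d0 : d != 0).

Lemma row_vconf : [/\ row 0 vconf = row3 1 0 0 *m B, row 1 vconf = row3 0 1 0 *m B,
  row 2 vconf = row3 a b 0 *m B, row 3 vconf = row3 0 0 1 *m B
  & row 4 vconf = row3 c 0 d *m B].
Proof.
split; rewrite rowK row3_frame /= !(scale0r, scale1r, addr0, add0r) //; exact: addrC.
Qed.

(** Divided by 3, the equations at the five points are the hypotheses of [tensor_normal_form], which
    determines every coefficient from that of x^3. *)
Lemma cubic_eigen_vcubic (f : {mpoly F[3]}) :
  cubic_form f -> has_eigenpoints f vconf -> s22 != 0 \/ s44 != 0 ->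
  exists2 k, k != 0 & f = vcubic k.
Proof.
move=> [fn0 hf] ev iso.
have uB := frame_unit.
have [t Ef] := cubic_coords uB hf.
rewrite -/B -/x -/m -/n in Ef.
have [le lp lr] := lin_form_frame.
have [[x0 m0 n0] [xp mp np] [xr mr nr]] := dir_deriv_frame_coord.
rewrite -!mpolyC1 -!mpolyC0 in x0 m0 n0 xp mp np xr mr nr.
have eq X M N : eigenpoint f (row3 X M N *m B) ->
  let q0 := t 0 0 0 * X ^+ 2 + 2 * t 0 0 1 * X * M + 2 * t 0 0 2 * X * N
    + t 0 1 1 * M ^+ 2 + t 0 2 2 * N ^+ 2 + 2 * t 0 1 2 * M * N in
  let q1 := t 1 1 1 * M ^+ 2 + t 0 0 1 * X ^+ 2 + 2 * t 0 1 1 * X * M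
    + 2 * t 1 1 2 * M * N + t 1 2 2 * N ^+ 2 + 2 * t 0 1 2 * X * N in
  let q2 := t 2 2 2 * N ^+ 2 + t 0 0 2 * X ^+ 2 + 2 * t 0 2 2 * X * N
    + t 1 1 2 * M ^+ 2 + 2 * t 1 2 2 * M * N + 2 * t 0 1 2 * X * M in
  [/\ s11 * X * q1 = (s22 * M + s24 * N) * q0,
      s11 * X * q2 = (s24 * M + s44 * N) * q0
    & (s22 * M + s24 * N) * q2 = (s24 * M + s44 * N) * q1].
  move=> evp q0 q1 q2; have [_ V] := (eigenpointP f _ uB).1 evp.
  have d3 (g : F) : 3 * g = 0 -> g = 0.
    by move=> /eqP; rewrite mulf_eq0 pnatr_eq0 => /eqP.
  have hx : x.@[(row3 X M N *m B) 0] = X by rewrite (meval_coord_frame uB) row3E.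
  have hm : m.@[(row3 X M N *m B) 0] = M by rewrite (meval_coord_frame uB) row3E.
  have hn : n.@[(row3 X M N *m B) 0] = N by rewrite (meval_coord_frame uB) row3E.
  have h0 : (dir_deriv e0 f).@[(row3 X M N *m B) 0] = 3 * q0.
    by rewrite (dir_deriv_cubic_eval _ Ef x0 m0 n0) hx hm hn /q0 /=; ring.
  have h1 : (dir_deriv p f).@[(row3 X M N *m B) 0] = 3 * q1.
    by rewrite (dir_deriv_cubic_eval _ Ef xp mp np) hx hm hn /q1 /=; ring.
  have h2 : (dir_deriv r f).@[(row3 X M N *m B) 0] = 3 * q2.
    by rewrite (dir_deriv_cubic_eval _ Ef xr mr nr) hx hm hn /q2 /=; ring.
  have hl0 : (lin_form e0).@[(row3 X M N *m B) 0] = s11 * X.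
    by rewrite le mevalM mevalC hx.
  have hl1 : (lin_form p).@[(row3 X M N *m B) 0] = s22 * M + s24 * N.
    by rewrite lp mevalD !mevalM !mevalC hm hn.
  have hl2 : (lin_form r).@[(row3 X M N *m B) 0] = s24 * M + s44 * N.
    by rewrite lr mevalD !mevalM !mevalC hm hn.
  have cancel3 (g h g' h' : F) : g * (3 * h) - g' * (3 * h') = 0 -> g * h = g' * h'.
    move=> e; apply/eqP; rewrite -subr_eq0; apply/eqP/d3; rewrite -[RHS]e; ring.
  have := V 1 2; have := V 0 2; have := V 0 1; rewrite !row_frame /contracted_minor.
  rewrite !mevalB !mevalM hl0 hl1 hl2 h0 h1 h2.
  by move=> /cancel3 v01 /cancel3 v02 /cancel3 v12.
have [r0 r1 r2 r3 r4] := row_vconf.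
have P1 := ev 0; have P2 := ev 1; have P3 := ev 2; have P4 := ev 3; have P5 := ev 4.
rewrite ?r0 ?r1 ?r2 ?r3 ?r4 in P1 P2 P3 P4 P5.
have [[h1 h2 h3 h4 h5] h111 h112 h122 h222] := tensor_normal_form s110 D0 a0 b0 c0 d0 iso
  (eq _ _ _ P1) (eq _ _ _ P2) (eq _ _ _ P3) (eq _ _ _ P4) (eq _ _ _ P5).
have sbd : s11 * b * d != 0 by rewrite !mulf_neq0 ?s110.
have fE : f = vcubic (t 0 0 0 / (s11 * b * d)).
  rewrite {1}Ef h1 h2 h3 h4 h5 h111 h112 h122 h222.
  have kE : t 0 0 0 = t 0 0 0 / (s11 * b * d) * (s11 * b * d) by rewrite divfK.
  rewrite {1}kE /vcubic; move: (t 0 0 0 / _) => k.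
  by rewrite !mpolyC0; ring.
exists (t 0 0 0 / (s11 * b * d)) => //; apply: contraNneq fn0 => k0.
by rewrite fE k0 /vcubic mpolyC0 mul0r.
Qed.

(* Here f has an extra parameter, the coefficient of x m n, so it gives no
   information, but the three conditions hold for every P. *)
Lemma isotropic_general : s22 = 0 -> s44 = 0 -> net_general vconf_al vconf_ga vconf_U vconf_W.
Proof.
move=> i2 i4; have s0 : s24 != 0.
  by apply: contraNneq D0 => s0; rewrite /D i2 s0; apply/eqP; ring.
have -> : vconf_al = - (s24 ^+ 2 * (a * d)) by rewrite /vconf_al /D i2; ring.
have -> : vconf_ga = - (s24 ^+ 2 * (b * c)) by rewrite /vconf_ga /D i2; ring.
have -> : vconf_U = - (2 * s24 ^+ 2 * (b * c)) by rewrite /vconf_U i4; ring.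
have -> : vconf_W = - (2 * s24 ^+ 2 * (a * d)) by rewrite /vconf_W i2; ring.
clear i2 i4.
split.
- have -> : - (s24 ^+ 2 * (b * c)) - - (2 * s24 ^+ 2 * (b * c)) = s24 ^+ 2 * (b * c) by ring.
  by rewrite !mulf_neq0 ?expf_neq0.
- have -> : - (s24 ^+ 2 * (a * d)) - - (2 * s24 ^+ 2 * (a * d)) = s24 ^+ 2 * (a * d) by ring.
  by rewrite !mulf_neq0 ?expf_neq0.
- set t := (X in X != 0).
  have -> : t = - (3 * s24 ^+ 4 * (a * b * c * d)) by rewrite /t; ring.
  by rewrite oppr_eq0 !mulf_neq0 ?expf_neq0 ?pnatr_eq0.
Qed.

(** mm and nn are linear in b c and a d with determinant (s22 s44 + s24^2)^2 - 4 s22 s44 s24^2 =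
    D^2. Eliminating a d yields the identity below. *)
Lemma mm_nn_neq0 : (mm != 0) || (nn != 0).
Proof.
rewrite -negb_and; apply/negP => /andP[/eqP m0 /eqP n0].
have : b * c * D ^+ 2 != 0 by rewrite !mulf_neq0 ?expf_neq0.
have -> : b * c * D ^+ 2 = mm * (s22 * s44 + s24 ^+ 2) + 2 * nn * s24 * s44.
  by rewrite /mm /nn /vconf_al /vconf_ga /vconf_U /vconf_W /D; ring.
by rewrite m0 n0 mulr0 !mul0r addr0 eqxx.
Qed.

Lemma al0 : vconf_al != 0. Proof. by rewrite !mulf_neq0. Qed.
Lemma ga0 : vconf_ga != 0. Proof. by rewrite !mulf_neq0. Qed.
Lemma be0 : vconf_be != 0. Proof. by rewrite !mulf_neq0. Qed.

Lemma eigenpoints_general (f : {mpoly F[3]}) : cubic_form f -> eigenscheme_reduced f ->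
  has_eigenpoints f vconf -> net_general vconf_al vconf_ga vconf_U vconf_W.
Proof.
move=> hf red ev; have [i2|i2] := eqVneq s22 0; last first.
  have [k k0 E'] := cubic_eigen_vcubic hf ev (or_introl i2); rewrite E' in red.
  exact: (reduced_net_general frame_unit (vcubic_span k0) be0 red mm_nn_neq0).
have [i4|i4] := eqVneq s44 0; first exact: isotropic_general.
have [k k0 E'] := cubic_eigen_vcubic hf ev (or_intror i4); rewrite E' in red.
exact: (reduced_net_general frame_unit (vcubic_span k0) be0 red mm_nn_neq0).
Qed.

Lemma row_seven (i : 'I_7) : exists2 w, w != 0 &
  row i (seven_points vconf) = w *: ((net_points vconf_al vconf_ga vconf_U vconf_W
      vconf_be)`_i *m B).
Proof.
have [r0 r1 r2 r3 r4] := row_vconf.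
have up (j : 'I_5) (k : 'I_7) : val k = val j ->
    row k (seven_points vconf) = row j vconf.
  move=> e; have -> : k = (lshift (1 + 1) j : 'I_7) by apply: val_inj.
  exact: rowKu.
have e5 (k : 'I_7) : val k = 5 -> row k (seven_points vconf) = point6 vconf.
  move=> e; have -> : k = (rshift 5 (lshift 1 (0 : 'I_1)) : 'I_7) by apply: val_inj.
  by rewrite [LHS]rowKd rowKu row_id.
have e6 (k : 'I_7) : val k = 6 -> row k (seven_points vconf) = point7 vconf.
  move=> e; have -> : k = (rshift 5 (rshift 1 (0 : 'I_1)) : 'I_7) by apply: val_inj.
  by rewrite [LHS]rowKd rowKd row_id.
case: i => [[|[|[|[|[|[|[|//]]]]]]] hi].
- by exists 1; rewrite ?oner_neq0 // scale1r (up 0) // r0.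
- by exists 1; rewrite ?oner_neq0 // scale1r (up 1) // r1.
- exists (D * d)^-1; rewrite ?invr_eq0 ?mulf_neq0 // (up 2) // r2 scalemxAl scale_row3.
  by congr (row3 _ _ _ *m _); rewrite /vconf_al /vconf_be; field; rewrite D0 d0.
- by exists 1; rewrite ?oner_neq0 // scale1r (up 3) // r3.
- exists (D * b)^-1; rewrite ?invr_eq0 ?mulf_neq0 // (up 4) // r4 scalemxAl scale_row3.
  by congr (row3 _ _ _ *m _); rewrite /vconf_ga /vconf_be; field; rewrite D0 b0.
- exists s11; rewrite ?s110 // e5 //.
  by rewrite point6_vconf row3_frame scale0r add0r.
- exists (s11 ^+ 3 * c * D); rewrite ?mulf_neq0 ?expf_neq0 ?s110 // e6 //.
  by rewrite point7_vconf row3_frame.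
Qed.

End Configuration.

Lemma in_triple n i j k (t : 'I_n.+1) :
  (t \in triple n i j k) = [|| t == inord i.-1, t == inord j.-1 | t == inord k.-1].
Proof. by rewrite !inE -orbA. Qed.

(** * Alignments of the seven points *)

Section NetConfiguration.
Variable F : numFieldType.
Variables (Q : 'M[F]_(7, 3)) (B : 'M[F]_3) (al ga U W be : F).
Hypotheses (uB : B \in unitmx) (gen : net_general al ga U W).
Hypotheses (al0 : al != 0) (ga0 : ga != 0) (be0 : be != 0).
Hypothesis rowQ : forall i : 'I_7, exists2 w, w != 0 &
  row i Q = w *: ((net_points al ga U W be)`_i *m B).

Let mm := ga - U.
Let nn := al - W.
Let E := al * mm + U * nn.

Let mm0 : mm != 0. Proof. by case: gen. Qed.
Let nn0 : nn != 0. Proof. by case: gen. Qed.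
Let E0 : E != 0. Proof. by case: gen. Qed.

Definition support (y : 'rV[F]_3) := (y 0 0 != 0, y 0 1 != 0, y 0 2 != 0).

(* The nonzero coordinates of the point labelled k are the binary digits 1 of k. *)
Lemma support_net (i : 'I_7) :
  support (net_points al ga U W be)`_i = (odd i.+1, odd i.+1./2, 3 <= i)%N.
Proof.
have bn : be * mm != 0 by rewrite mulf_neq0.
have bn' : be * nn != 0 by rewrite mulf_neq0.
case: i => [[|[|[|[|[|[|[|//]]]]]]] hi] /=; rewrite /support !row3E ?eqxx ?oner_neq0 //.
- by rewrite al0 be0.
- by rewrite ga0 be0.
- by rewrite mm0 nn0.
- by rewrite E0 bn bn'.
Qed.

(** Scaling keeps the set of nonzero coordinates, and by [support_net] this set identifies the
    label. *)
Lemma distinct_net : distinct_points Q.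
Proof.
have yB (y : 'rV[F]_3) : (y *m B == 0) = (y == 0).
  by apply/eqP/eqP => [e|->]; [rewrite -(mulmxK uB y) e mul0mx | rewrite mul0mx].
have s0 : support 0 = (false, false, false) by rewrite /support !mxE eqxx.
have supZ k y : k != 0 -> support (k *: y) = support y.
  by move=> k0; rewrite /support !mxE !mulf_eq0 (negPf k0).
have inj (i j : 'I_7) : (odd i.+1, odd i.+1./2, 3 <= i)%N = (odd j.+1, odd j.+1./2, 3 <=
    j)%N -> i = j.
  by case: i j => [[|[|[|[|[|[|[|//]]]]]]] hi] [[|[|[|[|[|[|[|//]]]]]]] hj] // _; apply:
      val_inj.
have r0 i : row i Q != 0.
  have [w w0 ->] := rowQ i; rewrite scaler_eq0 negb_or w0 yB; apply/eqP => y0.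
  have := support_net i; rewrite y0 s0.
  by case: i {y0} => [[|[|[|[|[|[|[|//]]]]]]] hi].
split=> // i j; apply: contraNN => /(same_pointP (r0 j)) [k k0].
have [w w0 ->] := rowQ i; have [w' w'0 ->] := rowQ j; rewrite scalerA !scalemxAl.
move=> /(can_inj (mulmxK uB)) => h; apply/eqP/inj; rewrite -!support_net.
by rewrite -(supZ w) // h supZ // mulf_neq0.
Qed.

Definition net_pairing (L0 L1 L2 : F) (t : nat) : F :=
  let y := (net_points al ga U W be)`_t in y 0 0 * L0 + y 0 1 * L1 + y 0 2 * L2.

Lemma aligned_net (T : {set 'I_7}) : aligned Q T <->
  exists L0 L1 L2 : F, [|| L0 != 0, L1 != 0 | L2 != 0] /\
    forall i : 'I_7, i \in T -> net_pairing L0 L1 L2 i = 0.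
Proof.
have ev (v : 'rV[F]_3) (L : 'cV[F]_3) :
    (v *m L == 0) = (v 0 0 * L 0 0 + v 0 1 * L 1 0 + v 0 2 * L 2 0 == 0).
  have -> : v 0 0 * L 0 0 + v 0 1 * L 1 0 + v 0 2 * L 2 0 = (v *m L) 0 0.
    by rewrite mxE sum3E.
  apply/eqP/eqP => [-> | h]; first by rewrite mxE.
  by apply/matrixP => i j; rewrite !ord1 h mxE.
split=> [[L Ln0 hL]|[L0 [L1 [L2 [Ln0 hL]]]]].
  pose M := B *m L; exists (M 0 0), (M 1 0), (M 2 0); split.
    apply: contraNT Ln0; rewrite !negb_or !negbK => /and3P[/eqP h0 /eqP h1 /eqP h2].
    have M0 : M = 0.
      by apply/matrixP => i j; rewrite ord1 [RHS]mxE; case: (ord3P i) => ->.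
    by rewrite -(mulKmx uB L) -/M M0 mulmx0.
  move=> i /hL; have [w w0 ->] := rowQ i; rewrite -scalemxAl -mulmxA => /eqP.
  by rewrite scaler_eq0 (negPf w0) /= ev => /eqP.
pose M := \col_(i < 3) [:: L0; L1; L2]`_i.
have [M0 M1 M2] : [/\ M 0 0 = L0, M 1 0 = L1 & M 2 0 = L2] by split; rewrite mxE.
exists (invmx B *m M).
  apply/eqP => /(congr1 (mulmx B)); rewrite mulKVmx // mulmx0 => h.
  by move: Ln0; rewrite -M0 -M1 -M2 h !mxE eqxx.
move=> i /hL; have [w w0 ->] := rowQ i => h; apply/eqP.
by rewrite -scalemxAl scaler_eq0 mulmxA mulmxK // ev M0 M1 M2; apply/orP; right; apply/eqP.
Qed.

Lemma net_pairingE (L0 L1 L2 : F) : let f := net_pairing L0 L1 L2 in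
  [/\ f 0 = L0, f 1 = L1 & f 2 = al * L0 + be * L1] /\
  [/\ f 3 = L2, f 4 = ga * L0 + be * L2, f 5 = mm * L1 + nn * L2
    & f 6 = E * L0 + be * (mm * L1 + nn * L2)].
Proof.
by rewrite /net_pairing /=; split; split; rewrite !row3E /E /mm /nn; ring.
Qed.

Lemma aligned_triple i j k : (0 < i <= 7)%N -> (0 < j <= 7)%N -> (0 < k <= 7)%N ->
  aligned Q (triple 6 i j k) <-> exists L0 L1 L2, [|| L0 != 0, L1 != 0 | L2 != 0] /\
    [/\ net_pairing L0 L1 L2 i.-1 = 0, net_pairing L0 L1 L2 j.-1 = 0
      & net_pairing L0 L1 L2 k.-1 = 0].
Proof.
have lt u : (0 < u <= 7)%N -> (u.-1 < 7)%N by case: u.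
move=> hi hj hk; split=> [/aligned_net|] [L0 [L1 [L2 [L hL]]]].
  exists L0, L1, L2; split=> //.
  have h t : (t \in [:: i.-1; j.-1; k.-1])%N -> (t < 7)%N -> net_pairing L0 L1 L2 t = 0.
    move=> tT t7; have := hL (inord t); rewrite inordK // => -> //.
    rewrite in_triple; move: tT; rewrite !inE.
    by move=> /or3P[] /eqP ->; rewrite eqxx ?orbT.
  by split; apply: h; rewrite ?lt // !inE eqxx ?orbT.
apply/aligned_net; exists L0, L1, L2; split=> // t.
by case: hL => h1 h2 h3; rewrite in_triple => /or3P[] /eqP ->; rewrite inordK ?lt.
Qed.

Lemma configuration_C5 : configuration C5_lines Q.
Proof.
split=> [|T]; first exact: distinct_net.
rewrite !inE -!orbA => /or4P[] /eqP ->; apply/aligned_triple => //.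
(* The four lines are n = 0, m = 0, nn m - mm n = 0 and x = 0. *)
- exists 0, 0, 1; rewrite oner_neq0 !orbT; split=> //.
  by have [[-> -> ->] _] := net_pairingE 0 0 1; split=> //; ring.
- exists 0, 1, 0; rewrite oner_neq0 !orbT; split=> //.
  by have [[-> _ _] [-> -> _ _]] := net_pairingE 0 1 0; split=> //; ring.
- exists 0, nn, (- mm); rewrite nn0 !orbT; split=> //.
  by have [[-> _ _] [_ _ -> ->]] := net_pairingE 0 nn (- mm); split=> //; ring.
- exists 1, 0, 0; rewrite oner_neq0; split=> //.
  by have [[_ -> _] [-> _ -> _]] := net_pairingE 1 0 0; split=> //; ring.
Qed.

(** Up to the factor -be, the determinant of the coordinates of P3, P5, P6. *)
Let K := al * mm + ga * nn.

(** The line P2 P5 is be x - ga n = 0, and at P7 this form takes the value be W mm. *)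
Lemma aligned_257 : aligned Q (triple 6 2 5 7) <-> W = 0.
Proof.
rewrite aligned_triple //; split=> [[L0 [L1 [L2 [L]]]]|W0].
  have [[_ -> _] [_ -> _ ->]] := net_pairingE L0 L1 L2 => -[L10 e5 e7].
  have L00 : L0 != 0.
    apply: contraTneq L => L00; move: e5; rewrite L00 L10 mulr0 add0r => /eqP.
    by rewrite mulf_eq0 (negPf be0) /= => ->; rewrite eqxx.
  apply/eqP; have : W * mm * L0 == 0; last by rewrite !mulf_eq0 (negPf mm0) (negPf L00) !orbF.
  apply/eqP; transitivity (E * L0 + be * (mm * L1 + nn * L2) - nn * (ga * L0 + be * L2)).
    by rewrite L10 /E /mm /nn; ring.
  by rewrite e5 e7; ring.
exists be, 0, (- ga); rewrite be0; split=> //.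
have [[_ -> _] [_ -> _ ->]] := net_pairingE be 0 (- ga).
by split=> //; rewrite /E /mm /nn ?W0; ring.
Qed.

(** The line P3 P4 is be x - al m = 0, and at P7 this form takes the value be U nn. *)
Lemma aligned_347 : aligned Q (triple 6 3 4 7) <-> U = 0.
Proof.
rewrite aligned_triple //; split=> [[L0 [L1 [L2 [L]]]]|U0].
  have [[_ _ ->] [-> _ _ ->]] := net_pairingE L0 L1 L2 => -[e3 L20 e7].
  have L00 : L0 != 0.
    apply: contraTneq L => L00; move: e3; rewrite L00 L20 mulr0 add0r => /eqP.
    by rewrite mulf_eq0 (negPf be0) /= => ->; rewrite eqxx.
  apply/eqP; have : U * nn * L0 == 0; last by rewrite !mulf_eq0 (negPf nn0) (negPf L00) !orbF.
  apply/eqP; transitivity (E * L0 + be * (mm * L1 + nn * L2) - mm * (al * L0 + be * L1)).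
    by rewrite L20 /E /mm /nn; ring.
  by rewrite e3 e7; ring.
exists be, (- al), 0; rewrite be0; split=> //.
have [[_ _ ->] [-> _ _ ->]] := net_pairingE be (- al) 0.
by split=> //; rewrite /E /mm /nn ?U0; ring.
Qed.

Lemma aligned_356 : aligned Q (triple 6 3 5 6) <-> K = 0.
Proof.
rewrite aligned_triple //; split=> [[L0 [L1 [L2 [L]]]]|K0].
  have [[_ _ ->] [_ -> -> _]] := net_pairingE L0 L1 L2 => -[e3 e5 e6].
  have L00 : L0 != 0.
    apply: contraTneq L => L00; move: e3 e5; rewrite L00 !mulr0 !add0r => /eqP e3 /eqP.
    by move: e3; rewrite !mulf_eq0 (negPf be0) /= => -> ->; rewrite eqxx.
  apply/eqP; have : K * L0 == 0; last by rewrite mulf_eq0 (negPf L00) orbF.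
  apply/eqP; transitivity (mm * (al * L0 + be * L1) + nn * (ga * L0 + be * L2)
     - be * (mm * L1 + nn * L2)); first by rewrite /K; ring.
  by rewrite e3 e5 e6; ring.
exists be, (- al), (- ga); rewrite be0; split=> //.
have [[_ _ ->] [_ -> -> _]] := net_pairingE be (- al) (- ga).
split; try ring; transitivity (- K); first by rewrite /K; ring.
by rewrite K0 oppr0.
Qed.

(* A further line contains one point of each of the pairs {2,3}, {4,5}, {6,7};
   {3,5,7} is never aligned, so only the three special triples remain. *)
Lemma strict_C5 : U != 0 -> W != 0 -> K != 0 -> strict_configuration C5_lines Q.
Proof.
move=> U0 W0 K0; split=> [|T T3 aT]; first exact: configuration_C5.
have a257 : ~ aligned Q (triple 6 2 5 7) by move/aligned_257/eqP; apply/negP.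
have a347 : ~ aligned Q (triple 6 3 4 7) by move/aligned_347/eqP; apply/negP.
have a356 : ~ aligned Q (triple 6 3 5 6) by move/aligned_356/eqP; apply/negP.
have [L0 [L1 [L2 [L hL]]]] := (aligned_net T).1 aT.
pose f := net_pairing L0 L1 L2; pose o t := f t == 0.
have TZ : T \subset [set i : 'I_7 | o i] by apply/subsetP => i /hL h; rewrite inE /o /f h.
have no (i j k : nat) : (0 < i <= 7)%N -> (0 < j <= 7)%N -> (0 < k <= 7)%N ->
    ~ aligned Q (triple 6 i j k) -> ~~ [&& o i.-1, o j.-1 & o k.-1].
  move=> hi hj hk nal; apply/negP => /and3P[/eqP oi /eqP oj /eqP ok]; apply: nal.
  by apply/aligned_triple => //; exists L0, L1, L2.
have n257 := no 2 5 7 isT isT isT a257; have n347 := no 3 4 7 isT isT isT a347.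
have n356 := no 3 5 6 isT isT isT a356; move: no a257 a347 a356 => _ _ _ _.
have [[f0 f1 f2] [f3 f4 f5 f6]] := net_pairingE L0 L1 L2; rewrite -/f in f0 f1 f2 f3 f4 f5 f6.
have oM (c z : F) : c != 0 -> (c * z == 0) = (z == 0) by move=> /negPf c0; rewrite mulf_eq0 c0.
have h357 : ~~ [&& o 2, o 4 & o 6].
  (* The values at P3 and P5 with weights mm and nn, minus the value at P7, add up to mm nn L0. So
     L0 = 0, and then be forces L1 = L2 = 0. *)
  apply/negP => /and3P[/eqP e3 /eqP e5 /eqP e7]; rewrite f2 in e3; rewrite f4 in e5.
  rewrite f6 in e7; have L00 : L0 == 0.
    have : mm * nn * L0 == 0; last by rewrite -mulrA !oM.
    apply/eqP; transitivity (mm * (al * L0 + be * L1) + nn * (ga * L0 + be * L2)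
      - (E * L0 + be * (mm * L1 + nn * L2))); first by rewrite /E /mm /nn; ring.
    by rewrite e3 e5 e7; ring.
  move: L; rewrite L00 /=.
  by move: e3 e5 => /eqP + /eqP; rewrite (eqP L00) !mulr0 !add0r !oM // => -> ->.
(* A form that vanishes at one point of a (C5) line vanishes at both or at neither of the other two.
   Two instances for each of the four lines suffice. *)
have h012 : o 0 -> o 1 = o 2.
  by rewrite /o f0 f1 f2 => /eqP ->; rewrite mulr0 add0r oM.
have h120 : o 1 -> o 0 = o 2.
  by rewrite /o f0 f1 f2 => /eqP ->; rewrite mulr0 addr0 oM.
have h034 : o 0 -> o 3 = o 4.
  by rewrite /o f0 f3 f4 => /eqP ->; rewrite mulr0 add0r oM.
have h340 : o 3 -> o 0 = o 4.
  by rewrite /o f0 f3 f4 => /eqP ->; rewrite mulr0 addr0 oM.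
have h135 : o 1 -> o 3 = o 5.
  by rewrite /o f1 f3 f5 => /eqP ->; rewrite mulr0 add0r oM.
have h351 : o 3 -> o 1 = o 5.
  by rewrite /o f1 f3 f5 => /eqP ->; rewrite mulr0 addr0 oM.
have h056 : o 0 -> o 5 = o 6.
  by rewrite /o f0 f6 -f5 => /eqP ->; rewrite mulr0 add0r oM.
have h560 : o 5 -> o 0 = o 6.
  by rewrite /o f0 f6 -f5 => /eqP ->; rewrite mulr0 addr0 oM.
have hn : ~~ [&& o 0, o 1 & o 3] by rewrite /o f0 f1 f3 !negb_and.
have cZ : #|[set i : 'I_7 | o i]| = (o 0 + (o 1 + (o 2 + (o 3 + (o 4 + (o 5 + o 6))))))%N.
  by rewrite -sum1_card big_mkcond !big_ord_recl big_ord0 !inE /= addn0.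
have := subset_leq_card TZ; rewrite T3 cZ => c3.
have TE i j k : (0 < i <= 7)%N -> (0 < j <= 7)%N -> (0 < k <= 7)%N ->
    (forall t, (t < 7)%N -> o t = (t \in [:: i.-1; j.-1; k.-1])) ->
    (o 0 + (o 1 + (o 2 + (o 3 + (o 4 + (o 5 + o 6))))) <= 3)%N -> T = triple 6 i j k.
  move=> hi hj hk ht le3; have lt u : (0 < u <= 7)%N -> (u.-1 < 7)%N by case: u.
  transitivity [set i : 'I_7 | o i]; first by apply/eqP; rewrite eqEcard TZ T3 cZ.
  apply/setP => t; rewrite in_triple inE ht // !inE.
  by rewrite -!val_eqE /= !inordK ?lt.
have o7 (P : nat -> bool) : o 0 = P 0 -> o 1 = P 1 -> o 2 = P 2 -> o 3 = P 3 -> o 4 = P 4 ->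
    o 5 = P 5 -> o 6 = P 6 -> forall t, (t < 7)%N -> o t = P t.
  by move=> ? ? ? ? ? ? ? [|[|[|[|[|[|[|]]]]]]].
have [T1|[T1|[T1|T1]]] : T = triple 6 1 2 3 \/ T = triple 6 1 4 5 \/
    T = triple 6 1 6 7 \/ T = triple 6 2 4 6; last first.
- by rewrite T1 !inE eqxx ?orbT.
- by rewrite T1 !inE eqxx ?orbT.
- by rewrite T1 !inE eqxx ?orbT.
- by rewrite T1 !inE eqxx ?orbT.
have E1 := TE 1 2 3 isT isT isT (o7 _ _ _ _ _ _ _ _).
have E2 := TE 1 4 5 isT isT isT (o7 _ _ _ _ _ _ _ _).
have E3 := TE 1 6 7 isT isT isT (o7 _ _ _ _ _ _ _ _).
have E4 := TE 2 4 6 isT isT isT (o7 _ _ _ _ _ _ _ _).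
(* Only the vanishing pattern of the form at the seven points is kept. Each of the 128 patterns is
   one of the four lines or contradicts an incidence or the count. *)
move: (o 0) (o 1) (o 2) (o 3) (o 4) (o 5) (o 6) n257 n347 n356 h357 h012 h120 h034 h340
  h135 h351 h056 h560 hn c3 E1 E2 E3 E4; clear.
move=> [] [] [] [] [] [] [] //= n257 n347 n356 h357 h012 h120 h034 h340
  h135 h351 h056 h560 hn c3 E1 E2 E3 E4;
  first [ by left; apply: E1 | by right; left; apply: E2
        | by right; right; left; apply: E3 | by right; right; right; apply: E4
        | by have := h012 isT | by have := h120 isT | by have := h034 isT
        | by have := h340 isT | by have := h135 isT | by have := h351 isT
        | by have := h056 isT | by have := h560 isT ].
Qed.

Lemma mem_triple_val i j k (t : 'I_7) :
  (0 < i <= 7)%N -> (0 < j <= 7)%N -> (0 < k <= 7)%N ->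
  (t \in triple 6 i j k) = (val t \in [:: i.-1; j.-1; k.-1]).
Proof.
have lt u : (0 < u <= 7)%N -> (u.-1 < 7)%N by case: u.
by move=> hi hj hk; rewrite in_triple !inE -!val_eqE /= !inordK ?lt.
Qed.

Lemma aligned_row_perm (s : {perm 'I_7}) (T T' : {set 'I_7}) :
  (forall i, i \in T -> s i \in T') -> aligned Q T' -> aligned (row_perm s Q) T.
Proof.
move=> sT [L L0 hL]; exists L => // i /sT /hL <-; congr (_ *m _).
by apply/matrixP => a b; rewrite !mxE.
Qed.

(** Besides the three lines through P1, (C8) has all but {3,5,6} of the triples {2,4,6}, {2,5,7},
    {3,4,7}, {3,5,6}. If {3,4,7} is the one not known to be aligned, swapping 4 with 5 and 6 with 7
    moves it to {3,5,6}; if it is {2,5,7}, swapping 2 with 3 and 6 with 7 does. *)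
Lemma configuration_C8 : (U = 0 /\ W = 0) \/ (W = 0 /\ K = 0) \/ (U = 0 /\ K = 0) ->
  exists s : {perm 'I_7}, configuration C8_lines (row_perm s Q).
Proof.
have rowP i s : row i (row_perm s Q) = row (s i) Q.
  by apply/matrixP => a b; rewrite !mxE.
have dist s : distinct_points (row_perm s Q).
  have [d0 d] := distinct_net; split=> [i|i j ij]; rewrite !rowP //.
  by apply: d; rewrite (inj_eq perm_inj).
have [_ C5] := configuration_C5.
have a123 : aligned Q (triple 6 1 2 3) by apply: C5; rewrite !inE eqxx ?orbT.
have a145 : aligned Q (triple 6 1 4 5) by apply: C5; rewrite !inE eqxx ?orbT.
have a167 : aligned Q (triple 6 1 6 7) by apply: C5; rewrite !inE eqxx ?orbT.
have a246 : aligned Q (triple 6 2 4 6) by apply: C5; rewrite !inE eqxx ?orbT.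
pose o k (hk : (k < 7)%N) := Ordinal hk.
have al_perm (s : {perm 'I_7}) (sv : seq nat) (i j k i' j' k' : nat) :
    (forall t : 'I_7, val (s t) = nth 0%N sv t) ->
    [&& 0 < i <= 7, 0 < j <= 7 & 0 < k <= 7]%N ->
    [&& 0 < i' <= 7, 0 < j' <= 7 & 0 < k' <= 7]%N ->
    all (fun t => nth 0%N sv t \in [:: i'.-1; j'.-1; k'.-1]) [:: i.-1; j.-1; k.-1] ->
    aligned Q (triple 6 i' j' k') -> aligned (row_perm s Q) (triple 6 i j k).
  move=> hs /and3P[hi hj hk] /and3P[hi' hj' hk'] /allP h.
  apply: aligned_row_perm => t; rewrite !mem_triple_val // hs => ht.
  exact: h.
move=> [[U0 W0]|[[W0 K0]|[U0 K0]]].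
- exists 1%g; split=> // T; have hs (t : 'I_7) : val ((1%g : {perm 'I_7}) t) = nth 0%N
    (iota 0 7) t.
    by rewrite perm1 nth_iota.
  rewrite !inE -!orbA.
  do ![case/orP]; move=> /eqP ->.
  + exact: (al_perm _ _ 1 2 3 1 2 3 hs).
  + exact: (al_perm _ _ 1 4 5 1 4 5 hs).
  + exact: (al_perm _ _ 1 6 7 1 6 7 hs).
  + exact: (al_perm _ _ 2 4 6 2 4 6 hs).
  + by apply: (al_perm _ _ 2 5 7 2 5 7 hs) => //; apply/aligned_257.
  + by apply: (al_perm _ _ 3 4 7 3 4 7 hs) => //; apply/aligned_347.
- pose s := (tperm (o 3 isT) (o 4 isT) * tperm (o 5 isT) (o 6 isT))%g.
  exists s; split=> // T.
  have hs (t : 'I_7) : val (s t) = nth 0%N [:: 0; 1; 2; 4; 3; 6; 5]%N t.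
    by case: t => [[|[|[|[|[|[|[|//]]]]]]] ht]; rewrite permM !permE.
  rewrite !inE -!orbA.
  do ![case/orP]; move=> /eqP ->.
  + exact: (al_perm _ _ 1 2 3 1 2 3 hs).
  + exact: (al_perm _ _ 1 4 5 1 4 5 hs).
  + exact: (al_perm _ _ 1 6 7 1 6 7 hs).
  + by apply: (al_perm _ _ 2 4 6 2 5 7 hs) => //; apply/aligned_257.
  + exact: (al_perm _ _ 2 5 7 2 4 6 hs).
  + by apply: (al_perm _ _ 3 4 7 3 5 6 hs) => //; apply/aligned_356.
- pose s := (tperm (o 1%N isT) (o 2 isT) * tperm (o 5 isT) (o 6 isT))%g.
  exists s; split=> // T.
  have hs (t : 'I_7) : val (s t) = nth 0%N [:: 0; 2; 1; 3; 4; 6; 5]%N t.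
    by case: t => [[|[|[|[|[|[|[|//]]]]]]] ht]; rewrite permM !permE.
  rewrite !inE -!orbA.
  do ![case/orP]; move=> /eqP ->.
  + exact: (al_perm _ _ 1 2 3 1 2 3 hs).
  + exact: (al_perm _ _ 1 4 5 1 4 5 hs).
  + exact: (al_perm _ _ 1 6 7 1 6 7 hs).
  + by apply: (al_perm _ _ 2 4 6 3 4 7 hs) => //; apply/aligned_347.
  + by apply: (al_perm _ _ 2 5 7 3 5 6 hs) => //; apply/aligned_356.
  + exact: (al_perm _ _ 3 4 7 2 4 6 hs).
Qed.
End NetConfiguration.

(** * Admissible quintuples and their parameters *)

(** These parameters describe exactly the admissible quintuples, by [general_admissible] and
    [admissible_vconf]. *)
Definition general_vconf (F : numFieldType) (p r : 'rV[F]_3) (l a b c d : F) :=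
  [/\ l != 0, gram_det p r != 0, [&& a != 0, b != 0, c != 0 & d != 0]
    & net_general (vconf_al p r a d) (vconf_ga p r b c) (vconf_U p r a b c d) (vconf_W p
        r a b c d)].

Section General.
Variable F : numFieldType.
Variables (p r : 'rV[F]_3) (l a b c d : F).
Hypothesis good : general_vconf p r l a b c d.

Let P := vconf p r l a b c d.
Let Q := seven_points P.
Let B := frame p r l.
Let al' := vconf_al p r a d.
Let ga' := vconf_ga p r b c.
Let be' := vconf_be p r b d.
Let U := vconf_U p r a b c d.
Let W := vconf_W p r a b c d.
Let K := al' * (ga' - U) + ga' * (al' - W).

Let l0 : l != 0. Proof. by case: good. Qed.
Let D0 : gram_det p r != 0. Proof. by case: good. Qed.
Let a0 : a != 0. Proof. by case: good => _ _ /and4P[]. Qed.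
Let b0 : b != 0. Proof. by case: good => _ _ /and4P[]. Qed.
Let c0 : c != 0. Proof. by case: good => _ _ /and4P[]. Qed.
Let d0 : d != 0. Proof. by case: good => _ _ /and4P[]. Qed.
Let gen : net_general al' ga' U W. Proof. by case: good. Qed.
Let alp0 : al' != 0. Proof. by rewrite !mulf_neq0. Qed.
Let gap0 : ga' != 0. Proof. by rewrite !mulf_neq0. Qed.
Let bep0 : be' != 0. Proof. by rewrite !mulf_neq0. Qed.
Let uB : B \in unitmx. Proof. exact: frame_unit. Qed.
Let rowQ (i : 'I_7) : exists2 w, w != 0 &
  row i Q = w *: ((net_points al' ga' U W be')`_i *m B).
Proof. exact: row_seven. Qed.

Lemma general_C5 : configuration C5_lines Q.
Proof. exact: (configuration_C5 uB gen alp0 gap0 bep0 rowQ). Qed.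

Lemma general_eigenpoints k : k != 0 ->
  cubic_with_7_eigenpoints (vcubic p r l a b c d k) /\
  eigenpoints_are (vcubic p r l a b c d k) Q.
Proof.
move=> k0; have hf := vcubic_homog p r l a b c d k.
have [red ev] := net_eigenpoints uB hf (vcubic_span a b c d l0 D0 k0) alp0 gap0 bep0 gen.
have epts : eigenpoints_are (vcubic p r l a b c d k) Q.
  split=> [i|v /ev [z hz [t t0 ->]]].
    have [w w0 ->] := rowQ i; apply/ev; exists (net_points al' ga' U W be')`_i; last by
        exists w.
    by rewrite mem_nth // (ltn_ord i).
  have hi : (index z (net_points al' ga' U W be') < 7)%N by move: hz; rewrite -index_mem.
  exists (Ordinal hi); have [w w0 ->] := rowQ (Ordinal hi); rewrite /= nth_index //.
  have -> : t *: (z *m B) = (t / w) *: (w *: (z *m B)) by rewrite scalerA divfK.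
  by rewrite same_pointZ // mulf_neq0 ?invr_eq0.
split=> //; split=> //; last first.
  exists [seq row i Q | i <- enum 'I_7] => v /epts.2 [i hi].
  by apply/hasP; exists (row i Q) => //; apply: (map_f (fun j => row j Q)); rewrite mem_enum.
split=> //; apply/eqP => f0.
have : (vcubic p r l a b c d k).@[(row3 1 0 0 *m B) 0] = 0 by rewrite f0 meval0.
rewrite /vcubic !(mevalM, mevalD, mevalC, rmorphXn) !(meval_coord_frame uB) !row3E.
set t := (X in X = 0); have -> : t = k * (l ^+ 2 * gram_det p r) * b * d.
  by rewrite /t /gram_det; ring.
move/eqP; rewrite !mulf_eq0 (negPf k0) (negPf b0) (negPf d0) (negPf l0).
by rewrite (negPf D0).
Qed.

(* Each factor of U, W or K that can vanish is shared with a second one of them,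
   so two of them vanish as soon as one does. *)
Let K_factor : K = 2 * gram_det p r * (a * d * dot p r - b * c * dot p p)
  * (b * c * dot p r - a * d * dot r r).
Proof. by rewrite /K /al' /ga' /U /W /vconf_al /vconf_ga /vconf_U /vconf_W /gram_det;
    ring. Qed.

Lemma general_strict : dot p r != 0 -> a * d * dot p r - b * c * dot p p != 0 ->
  b * c * dot p r - a * d * dot r r != 0 -> strict_configuration C5_lines Q.
Proof.
move=> h24 h2 h4; apply: (strict_C5 uB gen alp0 gap0 bep0 rowQ).
- rewrite mulf_neq0 ?mulf_neq0 ?pnatr_eq0 //.
  by rewrite -opprB oppr_eq0.
- rewrite mulf_neq0 ?mulf_neq0 ?pnatr_eq0 //.
  by rewrite -opprB oppr_eq0.
- by rewrite -/K K_factor !mulf_neq0 ?pnatr_eq0.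
Qed.

Lemma general_aligned : [/\ aligned Q (triple 6 2 5 7) <-> vconf_W p r a b c d = 0,
  aligned Q (triple 6 3 4 7) <-> vconf_U p r a b c d = 0
  & aligned Q (triple 6 3 5 6) <->
      (a * d * dot p r - b * c * dot p p) * (b * c * dot p r - a * d * dot r r) = 0].
Proof.
split; first exact: (aligned_257 uB gen bep0 rowQ).
  exact: (aligned_347 uB gen bep0 rowQ).
apply: (iff_trans (aligned_356 uB bep0 rowQ)); rewrite -/K K_factor.
split=> [/eqP|h]; last by rewrite -mulrA h mulr0.
by rewrite -mulrA mulf_eq0 mulf_eq0 pnatr_eq0 (negPf D0) /= => /eqP.
Qed.

Lemma general_C8 T : T \in special_lines -> aligned Q T ->
  exists s : {perm 'I_7}, configuration C8_lines (row_perm s Q).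
Proof.
move=> hT aT; apply: (configuration_C8 uB gen alp0 gap0 bep0 rowQ); rewrite -/K.
have two0 : (2 == 0 :> F) = false by rewrite pnatr_eq0.
have U0 : (U == 0) = (dot p r == 0) || (b * c * dot p r - a * d * dot r r == 0).
  by rewrite /U /vconf_U !mulf_eq0 two0 -opprB oppr_eq0.
have W0 : (W == 0) = (dot p r == 0) || (a * d * dot p r - b * c * dot p p == 0).
  by rewrite /W /vconf_W !mulf_eq0 two0 -opprB oppr_eq0.
have K0 : (K == 0) = (a * d * dot p r - b * c * dot p p == 0)
    || (b * c * dot p r - a * d * dot r r == 0).
  by rewrite K_factor !mulf_eq0 two0 (negPf D0).
have [U1|U1] := eqVneq U 0; have [W1|W1] := eqVneq W 0.
- by left.
- right; right; split=> //; apply/eqP; rewrite K0; move: W1 U0; rewrite U1 eqxx W0.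
  by case: (dot p r == 0) => //= _ <-; rewrite orbT.
- right; left; split=> //; apply/eqP; rewrite K0; move: U1 W0; rewrite W1 eqxx U0.
  by case: (dot p r == 0) => //= _ <-.
- have Kn : K != 0.
    by rewrite K0; move: U1 W1; rewrite U0 W0 !negb_or => /andP[_ ->] /andP[_ ->].
  move: hT aT; rewrite !inE -orbA => /or3P[] /eqP ->.
  + by move/(aligned_257 uB gen bep0 rowQ)/eqP; rewrite (negPf W1).
  + by move/(aligned_347 uB gen bep0 rowQ)/eqP; rewrite (negPf U1).
  + by move/(aligned_356 uB bep0 rowQ)/eqP; rewrite (negPf Kn).
Qed.

Lemma general_admissible : admissible P.
Proof.
have [[_ dist] C5] := general_C5; have [dist0 _] := general_C5.1.
pose e (j : 'I_5) : 'I_7 := lshift (1 + 1) j.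
have up (j : 'I_5) : row j P = row (e j) Q by apply/esym; exact: rowKu.
have [cub [ev _]] := general_eigenpoints (oner_neq0 F).
have [P1 P2 P3 P4 P5] := pt_vconf p r l a b c d.
have al57 i j k : [&& 0 < i <= 5, 0 < j <= 5 & 0 < k <= 5]%N ->
    aligned Q (triple 6 i j k) -> aligned P (triple 4 i j k).
  move=> /and3P[hi hj hk] [L L0 hL]; exists L => // t; rewrite in_triple => ht.
  rewrite up hL // in_triple -!val_eqE /=; move: ht; rewrite -!val_eqE /=.
  have lt5 u : (0 < u <= 5)%N -> (u.-1 < 5)%N by case: u.
  have lt7 u : (0 < u <= 5)%N -> (u.-1 < 7)%N by move/lt5/leq_trans; apply.
  by rewrite !inordK ?lt5 ?lt7.
split.
- split.
  + split=> [i|i j ij]; rewrite !up ?dist0 // dist //.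
  + by apply: al57 => //; apply: C5; rewrite !inE eqxx ?orbT.
  + by apply: al57 => //; apply: C5; rewrite !inE eqxx ?orbT.
  + move=> [L /negP L0 hL]; apply: L0; apply/eqP.
    have h k : (0 < k <= 5)%N -> k \in [:: 1; 2; 4]%N -> pt P k *m L = 0.
      move=> k5 hk; apply: hL; rewrite in_triple -!val_eqE /= !inordK //; last by case: k
          k5 hk.
      by move: hk; rewrite !inE => /or3P[] /eqP ->.
    rewrite -(mulKmx uB L); suff -> : B *m L = 0 by rewrite mulmx0.
    apply/row_matrixP => i; rewrite row_mul row0.
    case: (ord3P i) => ->; rewrite rowK /=.
    * by rewrite -P1; apply: h.
    * by rewrite -P2; apply: h.
    * by rewrite -P4; apply: h.
- by rewrite P1 P2 P4; apply: same_pointZ.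
- by exists (vcubic p r l a b c d 1) => // i; rewrite up.
Qed.

End General.

Lemma V_configuration_vconf (F : numFieldType) (P : 'M[F]_(5, 3)) :
  V_configuration P -> same_point (pt P 1) (cross (pt P 2) (pt P 4)) ->
  exists p r l a b c d, [/\ l != 0, gram_det p r != 0,
    [&& a != 0, b != 0, c != 0 & d != 0] & P = vconf p r l a b c d].
Proof.
move=> [[n0 dist] a123 a145 a124] P1.
have ptE k (i : 'I_5) : i = k.-1 :> nat -> pt P k = row i P.
  by move=> e; rewrite /pt; congr row; apply: val_inj; rewrite /= inordK -e.
rewrite (ptE 1%N 0) // (ptE 2 1) // (ptE 4 3) // in P1.
set p := row 1 P in P1; set r := row 3 P in P1.
have cn0 : cross p r != 0.
  apply: contraNneq (n0 0) => c0; move: P1; rewrite c0 /same_point => /andP[+ _].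
  by move/submx0null ->.
have [l l0 E1] := same_pointP cn0 P1.
have tripleP i j k (L : 'cV[F]_3) : [&& 0 < i <= 5, 0 < j <= 5 & 0 < k <= 5]%N ->
    (forall t, t \in triple 4 i j k -> row t P *m L = 0) <->
    [/\ pt P i *m L = 0, pt P j *m L = 0 & pt P k *m L = 0].
  move=> /and3P[hi hj hk]; split=> [h|[h1 h2 h3] t].
    by split; apply: h; rewrite in_triple eqxx ?orbT.
  by rewrite in_triple => /or3P[] /eqP ->.
(* The Gram determinant is the square of P2 x P4. If it were zero, then P1 would lie on its own
   polar line, which is the line P2 P4. *)
have D0 : gram_det p r != 0.
  rewrite /gram_det -dot_cross_cross; apply/negP => /eqP d0; apply: a124.
  exists (cross p r)^T.
    by apply: contraNneq cn0 => /(congr1 trmx); rewrite trmxK trmx0 => ->.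
  have dotT u : u *m (cross p r)^T = (dot (cross p r) u)%:M.
    apply/matrixP => i j; rewrite !ord1 !mxE; apply: eq_bigr => k _.
    by rewrite !mxE mulrC.
  apply/tripleP => //; rewrite (ptE 1%N 0) // (ptE 2 1) // (ptE 4 3) // E1 -/p -/r.
  split; first by rewrite -scalemxAl dotT d0 raddf0 scaler0.
  - by rewrite dotT dot_cross_l raddf0.
  - by rewrite dotT dot_cross_r raddf0.
have uB := frame_unit l0 D0.
have coords q : exists x m n, q = x *: (l *: cross p r) + m *: p + n *: r.
  have := row3_frame p r l ((q *m invmx (frame p r l)) 0 0)
    ((q *m invmx (frame p r l)) 0 1) ((q *m invmx (frame p r l)) 0 2).
  by rewrite -row3P mulmxKV // => ->; do 3!eexists.
have basis (L : 'cV[F]_3) : L != 0 -> (l *: cross p r) *m L = 0 -> p *m L = 0 ->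
    r *m L = 0 -> False.
  move=> /negP L0 h0 hp hr; apply: L0; apply/eqP.
  rewrite -(mulKmx uB L); suff -> : frame p r l *m L = 0 by rewrite mulmx0.
  apply/row_matrixP => i; rewrite row_mul row0.
  by case: (ord3P i) => ->; rewrite rowK.
have [a [b [a0 b0 E3]]] : exists a b, [/\ a != 0, b != 0 & row 2 P = b *: p + a *: (l *:
    cross p r)].
  have [L L0 hL] := a123; have := (tripleP 1 2 3 L isT).1 hL.
  rewrite (ptE 1%N 0) // (ptE 2 1) // (ptE 3 2) // -/p => -[h1 h2 h3].
  have [a [b [n E3]]] := coords (row 2 P); exists a, b.
  (* The line L contains P1 and P2, so by [basis] it misses P4, and the coordinate of P3 along P4 is
     zero. Distinctness from P2 and P1 then makes a and b nonzero. *)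
  have n00 : n = 0.
    move: h3; rewrite E3 !mulmxDl -!scalemxAl h2 scalemxAl -E1 h1 !scaler0 !add0r => /eqP.
    rewrite scaler_eq0 => /orP[/eqP //|/eqP h4]; case: (basis L) => //.
    by rewrite -E1.
  move: E3; rewrite n00 scale0r addr0 => E3; split; last by rewrite addrC.
  - apply/negP => /eqP a0; have := dist 2 1 isT; move/negP; apply.
    move: (n0 2); rewrite E3 a0 scale0r add0r scaler_eq0 negb_or => /andP[b0 _].
    exact: same_pointZ.
  - apply/negP => /eqP b0; have := dist 2 0 isT; move/negP; apply.
    move: (n0 2); rewrite E3 b0 scale0r addr0 -E1 scaler_eq0 negb_or => /andP[a0 _].
    exact: same_pointZ.
have [c [d [c0 d0 E5]]] : exists c d, [/\ c != 0, d != 0 & row 4 P = d *: r + c *: (l *: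
    cross p r)].
  have [L L0 hL] := a145; have := (tripleP 1 4 5 L isT).1 hL.
  rewrite (ptE 1%N 0) // (ptE 4 3) // (ptE 5 4) // -/r => -[h1 h4 h5].
  have [c [m [d E5]]] := coords (row 4 P); exists c, d.
  have m00 : m = 0.
    move: h5; rewrite E5 !mulmxDl -!scalemxAl h4 scalemxAl -E1 h1 !scaler0 addr0 add0r => /eqP.
    rewrite scaler_eq0 => /orP[/eqP //|/eqP h2]; case: (basis L) => //.
    by rewrite -E1.
  move: E5; rewrite m00 scale0r addr0 => E5; split; last by rewrite addrC.
  - apply/negP => /eqP c0; have := dist 4 3 isT; move/negP; apply.
    move: (n0 4); rewrite E5 c0 scale0r add0r scaler_eq0 negb_or => /andP[d0 _].
    exact: same_pointZ.
  - apply/negP => /eqP d0; have := dist 4 0 isT; move/negP; apply.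
    move: (n0 4); rewrite E5 d0 scale0r addr0 -E1 scaler_eq0 negb_or => /andP[c0 _].
    exact: same_pointZ.
exists p, r, l, a, b, c, d; split; rewrite ?a0 ?b0 ?c0 //.
have vi (i j : 'I_5) : val i = val j -> i = j by exact: val_inj.
apply/row_matrixP => -[[|[|[|[|[|//]]]]] hi]; rewrite rowK /=.
- by rewrite -E1; congr row; apply: vi.
- by congr row; apply: vi.
- by rewrite -E3; congr row; apply: vi.
- by congr row; apply: vi.
- by rewrite -E5; congr row; apply: vi.
Qed.

Lemma admissible_vconf (F : numFieldType) (P : 'M[F]_(5, 3)) : admissible P ->
  exists p r l a b c d, general_vconf p r l a b c d /\ P = vconf p r l a b c d.
Proof.
move=> [V P1 [f [cf red _] ev]].
have [p [r [l [a [b [c [d [l0 D0 nz EP]]]]]]]] := V_configuration_vconf V P1.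
exists p, r, l, a, b, c, d; split=> //; split=> //; case/and4P: nz => a0 b0 c0 d0.
by rewrite EP in ev; apply: (eigenpoints_general l0 D0 a0 b0 c0 d0 cf red ev).
Qed.

Lemma eigenpoints_seven (F : numFieldType) (P : 'M[F]_(5, 3)) (f : {mpoly F[3]}) :
  V_configuration P -> same_point (pt P 1) (cross (pt P 2) (pt P 4)) ->
  cubic_with_7_eigenpoints f -> has_eigenpoints f P ->
  [/\ dot (pt P 2) (pt P 2) != 0 \/ dot (pt P 4) (pt P 4) != 0 ->
        eigenpoints_are f (seven_points P),
    exists2 g : {mpoly F[3]}, cubic_with_7_eigenpoints g
      & eigenpoints_are g (seven_points P),
    aligned (seven_points P) (triple 6 2 4 6)
    & configuration C5_lines (seven_points P)].
Proof.
move=> V P1 [cf red zd] ev.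
have [p [r [l [a [b [c [d [l0 D0 nz EP]]]]]]]] := V_configuration_vconf V P1.
case/and4P: (nz) => a0 b0 c0 d0; rewrite EP in ev *.
have gen := eigenpoints_general l0 D0 a0 b0 c0 d0 cf red ev.
have good : general_vconf p r l a b c d by split.
have [_ -> _ -> _] := pt_vconf p r l a b c d.
have C5 := general_C5 good; split=> //.
- by move=> iso; have [k k0 ->] := cubic_eigen_vcubic l0 D0 a0 b0 c0 d0 cf ev iso;
    have [] := general_eigenpoints good k0.
- by have [] := general_eigenpoints good (oner_neq0 F); exists (vcubic p r l a b c d 1).
- by apply: C5.2; rewrite !inE eqxx ?orbT.
Qed.

(** * Examples of the special alignments *)

Section Example.
Variable F : numFieldType.

(** With these scalar products mm, nn and E evaluate to 1 or -1. *)
Lemma general_vconf_unit (p r : 'rV[F]_3) : gram_det p r = 1 ->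
  dot r r = 1 -> dot p r = 0 \/ dot p r = 1 -> general_vconf p r 1 1 1 1 1.
Proof.
move=> D1 h44 h24; have h22 : dot p p = 1 + dot p r ^+ 2.
  by move: D1; rewrite /gram_det h44 mulr1 => <-; ring.
rewrite /general_vconf D1 oner_neq0; split=> //.
rewrite /net_general /vconf_al /vconf_ga /vconf_U /vconf_W h44 h22 !mulr1; move: (dot p
    r) h24 => s h24.
have unit_neq0 (t u : F) : t = u -> (u == 1) || (u == - 1) -> t != 0.
  by move=> -> /orP[] /eqP ->; rewrite ?oppr_eq0 oner_neq0.
by case: h24 => ->; split;
  [ apply: (@unit_neq0 _ 1); [ring | rewrite eqxx ?orbT] .. |
    apply: (@unit_neq0 _ 1); [ring | rewrite eqxx ?orbT] |
    apply: (@unit_neq0 _ (- 1)); [ring | rewrite eqxx ?orbT] |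
    apply: (@unit_neq0 _ 1); [ring | rewrite eqxx ?orbT] ].
Qed.

(** With all five scalars equal to 1, orthogonal P2 and P4 make U and W vanish, while s24 = s44 = 1
    makes the second factor of K vanish. *)
Lemma special_example T : T \in special_lines ->
  exists2 P : 'M[F]_(5, 3), admissible P & aligned (seven_points P) T.
Proof.
have g0 : general_vconf (row3 0 1 0 : 'rV[F]_3) (row3 0 0 1) 1 1 1 1 1.
  apply: general_vconf_unit; rewrite /gram_det !dotE !row3E; try ring.
  by left; ring.
have g1 : general_vconf (row3 0 1 1 : 'rV[F]_3) (row3 0 0 1) 1 1 1 1 1.
  apply: general_vconf_unit; rewrite /gram_det !dotE !row3E; try ring.
  by right; ring.
have [a257 a347 _] := general_aligned g0; have [_ _ a356] := general_aligned g1.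
rewrite !inE -orbA => /or3P[] /eqP ->.
- eexists; [exact: (general_admissible g0) | apply/a257].
  by rewrite /vconf_W !dotE !row3E; ring.
- eexists; [exact: (general_admissible g0) | apply/a347].
  by rewrite /vconf_U !dotE !row3E; ring.
- eexists; [exact: (general_admissible g1) | apply/a356].
  by rewrite !dotE !row3E; ring.
Qed.
End Example.

(** * Density *)

Section PolynomialFunctions.
Variable F : numFieldType.

(** A bare existence statement, so that the functions on the segment below are seen to be polynomial
    by closure rules, without computing coefficients. *)
Definition polyfun (f : F -> F) := exists q : {poly F}, forall t, f t = q.[t].

Lemma polyfun_cst c : polyfun (fun=> c).
Proof. by exists c%:P => t; rewrite hornerC. Qed.

Lemma polyfun_id : polyfun id.
Proof. by exists 'X => t; rewrite hornerX. Qed.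

Lemma polyfunD f g : polyfun f -> polyfun g -> polyfun (fun t => f t + g t).
Proof. by move=> [p hp] [q hq]; exists (p + q) => t; rewrite hornerD hp hq. Qed.

Lemma polyfunN f : polyfun f -> polyfun (fun t => - f t).
Proof. by move=> [p hp]; exists (- p) => t; rewrite hornerN hp. Qed.

Lemma polyfunM f g : polyfun f -> polyfun g -> polyfun (fun t => f t * g t).
Proof. by move=> [p hp] [q hq]; exists (p * q) => t; rewrite hornerM hp hq. Qed.

Lemma polyfunX f n : polyfun f -> polyfun (fun t => f t ^+ n).
Proof. by move=> [p hp]; exists (p ^+ n) => t; rewrite horner_exp hp. Qed.

Lemma polyfun_sum I (s : seq I) (P : pred I) (f : I -> F -> F) :
  (forall i, polyfun (f i)) -> polyfun (fun t => \sum_(i <- s | P i) f i t).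
Proof.
move=> hf; elim: s => [|i s [q hq]].
  by exists 0 => t; rewrite big_nil horner0.
have [p hp] := hf i; exists (if P i then p + q else q) => t.
by rewrite big_cons hq hp; case: (P i); rewrite ?hornerD.
Qed.

Lemma polyfun_prod I (s : seq I) (P : pred I) (f : I -> F -> F) :
  (forall i, polyfun (f i)) -> polyfun (fun t => \prod_(i <- s | P i) f i t).
Proof.
move=> hf; elim: s => [|i s [q hq]].
  by exists 1 => t; rewrite big_nil hornerC.
have [p hp] := hf i; exists (if P i then p * q else q) => t.
by rewrite big_cons hq hp; case: (P i); rewrite ?hornerM.
Qed.

Lemma polyfun_ext f g : f =1 g -> polyfun g -> polyfun f.
Proof. by move=> e [q hq]; exists q => t; rewrite e hq. Qed.

Lemma polyfun_meval n (H : {mpoly F[n]}) (v : F -> 'I_n -> F) :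
  (forall i, polyfun (fun t => v t i)) -> polyfun (fun t => H.@[v t]).
Proof.
move=> hv; apply: (@polyfun_ext _ _ (fun t => mevalE (v t) H)).
apply: polyfun_sum => m; apply: polyfunM; first exact: polyfun_cst.
by apply: polyfun_prod => i; apply: polyfunX.
Qed.

Lemma polyfun_dot (u v : F -> 'rV[F]_3) : (forall k, polyfun (fun t => u t 0 k)) ->
  (forall k, polyfun (fun t => v t 0 k)) -> polyfun (fun t => dot (u t) (v t)).
Proof. by move=> hu hv; apply: polyfun_sum => k; apply: polyfunM. Qed.

Lemma polyfun_cross (u v : F -> 'rV[F]_3) k : (forall k, polyfun (fun t => u t 0 k)) ->
  (forall k, polyfun (fun t => v t 0 k)) -> polyfun (fun t => cross (u t) (v t) 0 k).
Proof.
move=> hu hv; apply: (@polyfun_ext _ _ (fun t => mxE _ _ _ _)).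
by apply: polyfunD; [|apply: polyfunN]; apply: polyfunM.
Qed.

(** The product of three nonzero polynomials cannot have as many roots as its size, and in
    characteristic zero the naturals supply that many distinct points. *)
Lemma polyfun_neq0 (f g h : F -> F) : polyfun f -> polyfun g -> polyfun h ->
  (exists t, f t != 0) -> (exists t, g t != 0) -> (exists t, h t != 0) ->
  exists t, [/\ f t != 0, g t != 0 & h t != 0].
Proof.
move=> [p hp] [q hq] [s hs] [x fx] [y gy] [z hz].
have nz (w : {poly F}) u : w.[u] != 0 -> w != 0.
  by apply: contraNneq => ->; rewrite horner0.
have p0 : p != 0 by apply: (nz _ x); rewrite -hp.
have q0 : q != 0 by apply: (nz _ y); rewrite -hq.
have s0 : s != 0 by apply: (nz _ z); rewrite -hs.
have w0 : p * q * s != 0 by rewrite !mulf_neq0.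
pose rs : seq F := [seq k%:R | k <- iota 0 (size (p * q * s))].
have us : uniq rs.
  rewrite map_inj_uniq ?iota_uniq // => i j /eqP.
  by rewrite eqr_nat => /eqP.
have [ar|] := boolP (all (root (p * q * s)) rs).
  by have := max_poly_roots w0 ar us; rewrite size_map size_iota ltnn.
move=> /allPn [t _]; rewrite /root !hornerM !mulf_eq0 !negb_or -hp -hq -hs.
by move=> /andP[/andP[h1 h2] h3]; exists t.
Qed.
End PolynomialFunctions.

Section Density.
Variable F : numFieldType.

Definition multideg (m : 'X_{1..5 * 3}) (i : 'I_5) : nat :=
  (\sum_(k < 3) m (mxvec_index i k))%N.

Definition of_multidegree (e : 'I_5 -> nat) (G : {mpoly F[5 * 3]}) :=
  forall m, m \in msupp G -> forall i, multideg m i = e i.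

Lemma multidegreeD e G H : of_multidegree e G -> of_multidegree e H -> of_multidegree e
    (G + H).
Proof. by move=> hG hH m /msuppD_le; rewrite mem_cat => /orP[/hG|/hH]. Qed.

Lemma multidegreeB e G H : of_multidegree e G -> of_multidegree e H -> of_multidegree e
    (G - H).
Proof. by move=> hG hH; apply: multidegreeD => // m; rewrite (perm_mem (msuppN H)) => /hH. Qed.

Lemma multidegreeM e e' G H : of_multidegree e G -> of_multidegree e' H ->
  of_multidegree (fun i => e i + e' i)%N (G * H).
Proof.
move=> hG hH m /msuppM_le /allpairsP[[m1 m2] [/= /hG h1 /hH h2 ->]] i.
rewrite -h1 -h2 -big_split; apply: eq_bigr => k _ /=; exact: mnmDE.
Qed.

Lemma multidegree_sum e (G : 'I_3 -> {mpoly F[5 * 3]}) :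
  (forall k, of_multidegree e (G k)) -> of_multidegree e (\sum_k G k).
Proof. by move=> hG; rewrite sum3E; do !apply: multidegreeD. Qed.

Lemma multidegree_ext e e' G : e =1 e' -> of_multidegree e G -> of_multidegree e' G.
Proof. by move=> ee hG m /hG h i; rewrite h ee. Qed.

Definition point_dot (i j : 'I_5) : {mpoly F[5 * 3]} :=
  \sum_k 'X_(mxvec_index i k) * 'X_(mxvec_index j k).

Lemma multidegree_point_dot i j :
  of_multidegree (fun s => (s == i) + (s == j))%N (point_dot i j).
Proof.
have inj t k u l : (mxvec_index t k == mxvec_index u l :> 'I_(5 * 3)) = (t == u) && (k == l).
  by rewrite (inj_eq (@cast_ord_inj _ _ _)) (inj_eq enum_rank_inj).
have hX t k : of_multidegree (fun s => (s == t) : nat) ('X_(mxvec_index t k)).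
  move=> m; rewrite msuppX inE => /eqP -> s; rewrite /multideg (bigD1 k) //= mnm1E inj.
  rewrite eqxx andbT eq_sym big1 ?addn0 // => l lk.
  by rewrite mnm1E inj [k == l]eq_sym (negPf lk) andbF.
by apply: multidegree_sum => k; apply: multidegreeM.
Qed.

Lemma meval_point_dot (P : 'M[F]_(5, 3)) i j :
  (point_dot i j).@[mxvec P 0] = dot (row i P) (row j P).
Proof.
rewrite /point_dot /dot !raddf_sum; apply: eq_bigr => k _ /=.
by rewrite mevalM !mevalXU !mxvecE !mxE.
Qed.

(** This is s24 (s13 s25 - s15 s23) (s15 s34 - s13 s45). It restates the three conditions of
    [general_strict] in terms of the points, because genericity is tested by polynomials in their
    coordinates and not in the parameters. *)
Definition strictness : {mpoly F[5 * 3]} := point_dot 1 3 *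
  (point_dot 0 2 * point_dot 1 4 - point_dot 0 4 * point_dot 1 2) *
  (point_dot 0 4 * point_dot 2 3 - point_dot 0 2 * point_dot 3 4).

Lemma strictness_multihomogeneous : multihomogeneous strictness.
Proof.
have hD := multidegree_point_dot.
eexists; apply: multidegreeM; first apply: multidegreeM; first exact: hD.
  apply: multidegreeB; first by apply: multidegreeM; apply: hD.
  by apply: multidegree_ext; last (apply: multidegreeM; apply: hD); move=> s /=; ring.
apply: multidegreeB; first by apply: multidegreeM; apply: hD.
by apply: multidegree_ext; last (apply: multidegreeM; apply: hD); move=> s /=; ring.
Qed.

Lemma strictness_vconf (p r : 'rV[F]_3) l a b c d :
  strictness.@[mxvec (vconf p r l a b c d) 0] = dot p r * (l ^+ 2 * gram_det p r) ^+ 2 *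
   (a * d * dot p r - b * c * dot p p) * (b * c * dot p r - a * d * dot r r).
Proof.
have rw i : row i (vconf p r l a b c d) =
    [:: l *: cross p r; p; b *: p + a *: (l *: cross p r); r; d *: r + c *: (l *: cross p
        r)]`_i.
  exact: rowK.
rewrite /strictness !(mevalM, mevalB) !meval_point_dot !rw /=.
move: (dot00 p r l) (dot0p p r l) (dot0r p r l) (dotp0 p r l) (dotr0 p r l).
move: (l *: cross p r) => e ee ep er pe re.
rewrite !(dotDl, dotDr, dotZl, dotZr) ee ep er ?pe ?re /gram_det; ring.
Qed.

(** All conditions of [general_vconf] in one product, so that on a segment admissibility is the
    nonvanishing of a single polynomial function. *)
Definition general_parameters (p r : 'rV[F]_3) (l a b c d : F) : F :=
  l * gram_det p r * a * b * c * d * (vconf_ga p r b c - vconf_U p r a b c d)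
  * (vconf_al p r a d - vconf_W p r a b c d) * (vconf_al p r a d * (vconf_ga p r b c -
      vconf_U p r a b c d)
     + vconf_U p r a b c d * (vconf_al p r a d - vconf_W p r a b c d)).

Lemma general_vconfP (p r : 'rV[F]_3) l a b c d :
  general_vconf p r l a b c d <-> general_parameters p r l a b c d != 0.
Proof.
rewrite /general_parameters !mulf_eq0 !negb_or -!andbA; split.
  by move=> [-> -> /and4P[-> -> -> ->] [-> -> ->]].
move=> /and5P[h1 h2 h3 h4 /and5P[h5 h6 h7 h8 h9]].
by split=> //; apply/and4P.
Qed.

(* Join the parameters of P0 to those of an explicit strict configuration by a
   segment: the three conditions are polynomial in the parameter t, and each of
   them holds at t = 0 or t = 1. *)
Lemma strict_for_general : holds_for_general (@admissible F)
  (fun P => strict_configuration C5_lines (seven_points P)).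
Proof.
exists [:: strictness]; split=> [G|H hH [P0 W0 H0]|P].
- by rewrite inE => /eqP ->; exact: strictness_multihomogeneous.
- have [p [r [l [a [b [c [d [good EP]]]]]]]] := admissible_vconf W0.
  pose seg (x y t : F) := x + t * (y - x).
  pose vseg (u v : 'rV[F]_3) (t : F) := u + t *: (v - u).
  have seg0 x y : seg x y 0 = x by rewrite /seg mul0r addr0.
  have seg1 x y : seg x y 1 = y by rewrite /seg mul1r addrC subrK.
  have vseg0 u v : vseg u v 0 = u by rewrite /vseg scale0r addr0.
  have vseg1 u v : vseg u v 1 = v by rewrite /vseg scale1r addrC subrK.
  have pseg x y : polyfun (seg x y).
    by apply: polyfunD; [|apply: polyfunM]; (exact: polyfun_cst || exact: polyfun_id).
  have pvseg u v k : polyfun (fun t => vseg u v t 0 k).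
    apply: (@polyfun_ext _ _ (seg (u 0 k) (v 0 k))) => // t.
    by rewrite /vseg /seg !mxE.
  pose pt t := vseg p (row3 0 1 1) t; pose rt t := vseg r (row3 0 0 1) t.
  pose lt := seg l 1; pose at_ := seg a 1; pose bt := seg b 1.
  (* The end point is the example with s24 = s44 = 1 above, except for c = 2: with c = 1 the last
     factor of [g] would vanish there. *)
  pose ct := seg c 2; pose dt := seg d 1.
  pose Pt t := vconf (pt t) (rt t) (lt t) (at_ t) (bt t) (ct t) (dt t).
  have ppr : polyfun (fun t => dot (pt t) (rt t)) by apply: polyfun_dot; apply: pvseg.
  have ppp : polyfun (fun t => dot (pt t) (pt t)) by apply: polyfun_dot; apply: pvseg.
  have prr : polyfun (fun t => dot (rt t) (rt t)) by apply: polyfun_dot; apply: pvseg.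
  have pH : polyfun (fun t => H.@[mxvec (Pt t) 0]).
    apply: polyfun_meval => i; case/mxvec_indexP: i => i k.
    have vE : (fun t => mxvec (Pt t) 0 (mxvec_index i k)) =1 fun t => row i (Pt t) 0 k.
      by move=> t; rewrite mxvecE [RHS]mxE.
    apply: (polyfun_ext vE); have pc : polyfun (fun t => (lt t *: cross (pt t) (rt t)) 0 k).
      apply: (@polyfun_ext _ _ (fun t => lt t * cross (pt t) (rt t) 0 k)).
        by move=> t; rewrite mxE.
      by apply: polyfunM; [exact: pseg | apply: polyfun_cross; exact: pvseg].
    have pc2 (u v : F -> 'rV[F]_3) (x y : F -> F) : polyfun x -> polyfun y ->
        polyfun (fun t => u t 0 k) -> polyfun (fun t => v t 0 k) ->
        polyfun (fun t => (x t *: u t + y t *: v t) 0 k).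
      move=> px py pu pv.
      apply: (@polyfun_ext _ _ (fun t => x t * u t 0 k + y t * v t 0 k)).
        by move=> t; rewrite !mxE.
      by apply: polyfunD; apply: polyfunM.
    case: i {vE} => [[|[|[|[|[|//]]]]] hi].
    + by apply: polyfun_ext pc => t; rewrite rowK.
    + by apply: polyfun_ext (pvseg p (row3 0 1 1) k) => t; rewrite rowK.
    + apply: (@polyfun_ext _ _ (fun t => (bt t *: pt t
        + at_ t *: (lt t *: cross (pt t) (rt t))) 0 k)); first by move=> t; rewrite rowK.
      by apply: pc2; (exact: pseg || exact: pvseg || exact: pc).
    + by apply: polyfun_ext (pvseg r (row3 0 0 1) k) => t; rewrite rowK.
    + apply: (@polyfun_ext _ _ (fun t => (dt t *: rt t
        + ct t *: (lt t *: cross (pt t) (rt t))) 0 k)); first by move=> t; rewrite rowK.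
      by apply: pc2; (exact: pseg || exact: pvseg || exact: pc).
  have pM : polyfun (fun t => general_parameters (pt t) (rt t) (lt t) (at_ t) (bt t) (ct
      t) (dt t)).
    rewrite /general_parameters /vconf_al /vconf_ga /vconf_U /vconf_W /gram_det.
    by repeat (assumption || exact: pseg || exact: polyfun_cst
      || apply: polyfunM || apply: polyfunD || apply: polyfunN || apply: polyfunX).
  pose g t := dot (pt t) (rt t) * (at_ t * dt t * dot (pt t) (rt t) - bt t * ct t * dot
      (pt t) (pt t))
     * (bt t * ct t * dot (pt t) (rt t) - at_ t * dt t * dot (rt t) (rt t)).
  have pg : polyfun g.
    by repeat (assumption || exact: pseg || apply: polyfunM || apply: polyfunD || apply:
        polyfunN).
  have [] := polyfun_neq0 pH pM pg.
  + by exists 0; rewrite /Pt /pt /rt /lt /at_ /bt /ct /dt !vseg0 !seg0 -EP.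
  + by exists 0; rewrite /pt /rt /lt /at_ /bt /ct /dt !vseg0 !seg0; apply/general_vconfP.
  + exists 1; rewrite /g /pt /rt /lt /at_ /bt /ct /dt !vseg1 !seg1 !dotE !row3E.
    set u := (X in X != 0); have -> : u = - 3 by rewrite /u; ring.
    by rewrite oppr_eq0 pnatr_eq0.
  move=> t [Ht Mt gt]; have good' := (general_vconfP _ _ _ _ _ _ _).2 Mt.
  exists (Pt t); split=> //; first exact: general_admissible.
  rewrite /= orbF /nonvanishing /Pt strictness_vconf.
  move: gt; rewrite /g !mulf_eq0 !negb_or => /andP[/andP[-> ->] ->]; rewrite !andbT /=.
  by have [/negPf l0 /negPf D0 _ _] := good'; rewrite ?mulf_eq0 l0 D0.
- move=> /admissible_vconf [p [r [l [a [b [c [d [good ->]]]]]]]].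
  rewrite /= orbF /nonvanishing strictness_vconf !mulf_eq0 !negb_or.
  by move=> /andP[/andP[/andP[h24 _] h2] h4]; apply: general_strict.
Qed.
End Density.

Theorem proposition7p4 (R : realType) :
  [/\ forall (P : 'M[R[i]]_(5, 3)) (f : {mpoly R[i][3]}),
        V_configuration P ->
        same_point (pt P 1) (cross (pt P 2) (pt P 4)) ->
        cubic_with_7_eigenpoints f ->
        has_eigenpoints f P ->
        [/\ (* P2 and P4 are not both isotropic: otherwise f is not determined
               by P, and only the existence of g below is true *)
            dot (pt P 2) (pt P 2) != 0 \/ dot (pt P 4) (pt P 4) != 0 ->
              eigenpoints_are f (seven_points P),
            exists2 g : {mpoly R[i][3]}, cubic_with_7_eigenpoints g
              & eigenpoints_are g (seven_points P),
            aligned (seven_points P) (triple 6 2 4 6)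
          & configuration C5_lines (seven_points P)],
      holds_for_general (@admissible R[i])
        (fun P => strict_configuration C5_lines (seven_points P)),
      forall T, T \in special_lines ->
        exists2 P : 'M[R[i]]_(5, 3), admissible P & aligned (seven_points P) T
    & forall (P : 'M[R[i]]_(5, 3)) T, admissible P -> T \in special_lines ->
        aligned (seven_points P) T ->
        exists s : {perm 'I_7},
          configuration C8_lines (row_perm s (seven_points P))].
Proof.
split.
- move=> P f V P1 cf ev; exact: eigenpoints_seven V P1 cf ev.
- exact: strict_for_general.
- exact: special_example.
- move=> P T /admissible_vconf [p [r [l [a [b [c [d [good ->]]]]]]]].
  exact: general_C8.
Qed.
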